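(* Let $G\iota:\mathrm{cZSet}\to\mathrm{Gph}$ be the composite of the inclusion $\iota:\mathrm{cZSet}\to\mathrm{ZSet}$ with the functor $G:\mathrm{ZSet}\to\mathrm{Gph}$, and let $jH:\mathrm{Gph}\to\mathrm{cZSet}$ be the composite of $H:\mathrm{Gph}\to\mathrm{ZSet}$ with the periodic part functor $j:\mathrm{ZSet}\to\mathrm{cZSet}$. Then the pair $(G\iota, jH)$ (with left adjoint $G\iota$ and right adjoint $jH$) is a Quillen equivalence between $\mathrm{cZSet}$ and $\mathrm{Gph}$. So the homotopy category $\mathrm{Ho}(\mathrm{Gph})$ is equivalent to the category $\mathrm{cZSet}$.
   Context: A graph is $X=(X_0,X_1,s,t)$ with a set $X_0$ of nodes, a set $X_1$ of arcs, and functions $s,t:X_1\to X_0$ (source, target). A graph morphism $f:X\to Y$ is a pair $f_0:X_0\to Y_0$, $f_1:X_1\to Y_1$ with $s f_1=f_0 s$, $t f_1=f_0 t$. This is the category $\mathrm{Gph}$. For $n>0$, the cycle graph $\mathbf{C}_n$ has $\mathbb{Z}/n$ as nodes and as arcs, with $s(i)=i+1$, $t(i)=i$; $C_n(X)$ is the set of graph morphisms $\mathbf{C}_n\to X$. An N-set is a pair $(S,\sigma)$ with $S$ a set and $\sigma:S\to S$ a function; a Z-set is an N-set with $\sigma$ bijective. Maps are functions commuting with the $\sigma$'s. $\mathrm{ZSet}$ is the category of Z-sets, and $\mathrm{cZSet}$ is the full subcategory of those $(S,\sigma)$ in which every $x\in S$ is periodic ($\sigma^n(x)=x$ for some $n>0$).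 The functor $j$ sends $(S,\sigma)$ to its subset of periodic elements with the restriction of $\sigma$. $G(S,\sigma)$ is the graph with nodes $S$, arcs $S$, and $s(x)=\sigma(x)$, $t(x)=x$. $\mathbf{Z}$ is the line graph $G(\mathbb{Z},m\mapsto m+1)$, and $H(X)$ is the set of graph morphisms $\mathbf{Z}\to X$, with $\sigma$ given by precomposition with the shift $m\mapsto m+1$; $H$ is right adjoint to $G$, and $j$ is right adjoint to $\iota$. Weak orthogonality: $\ell\dagger r$ means every commutative square with left side $\ell$ and right side $r$ has a diagonal filler; ${}^\dagger\mathcal{F}=\{\ell:\ell\dagger f\ \forall f\in\mathcal{F}\}$. Model structure on $\mathrm{Gph}$: the weak equivalences are the Acyclic graph morphisms ($C_n(f)$ is bijective for all $n>0$); the fibrations are the Surjecting graph morphisms (for every node $x$, $f$ maps the arcs with source $x$ onto the arcs with source $f(x)$); the cofibrations are ${}^\dagger\underline{\mathcal{F}}$ where $\underline{\mathcal{F}}$ is the class of Acyclic Surjectings. The category $\mathrm{cZSet}$ has the trivial model structure: all maps are cofibrations and fibrations, and weak equivalences are the isomorphisms. $\mathrm{Ho}(\mathcal{E})$ is the localization of $\mathcal{E}$ at its weak equivalences. A Quillen adjunction $(L,R)$ is an adjunction between model categories such that $L$ preserves cofibrations and acyclic cofibrations; it is a Quillen equivalence when the derived adjunction $(L',R')$ between the homotopy categories is an equivalence of categories. *)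

(* Defs.v *)
From mathcomp Require Import all_boot ssralg ssrint boolp.

Set Implicit Arguments.
Unset Strict Implicit.
Unset Printing Implicit Defensive.

Lemma sval_eq (T : Type) (P : T -> Prop) (x y : {x : T | P x}) :
  sval x = sval y -> x = y.
Proof. by case: x y => x px [y py] /=; apply: eq_exist. Qed.

Record category := Category {
  obj :> Type;
  hom : obj -> obj -> Type;
  idm : forall x, hom x x;
  comp : forall x y z, hom y z -> hom x y -> hom x z;
  compA : forall x y z t (h : hom z t) (g : hom y z) (f : hom x y),
    comp h (comp g f) = comp (comp h g) f;
  comp1m : forall x y (f : hom x y), comp (idm y) f = f;
  compm1 : forall x y (f : hom x y), comp f (idm x) = f }.

Arguments hom {c} x y.
Arguments idm {c} x.
Arguments comp {c x y z} g f.

Declare Scope cat_scope.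
Delimit Scope cat_scope with cat.
Local Open Scope cat_scope.
Notation "g \oc f" := (comp g f) (at level 50, left associativity) : cat_scope.

Definition is_iso (C : category) (x y : C) (f : hom x y) : Prop :=
  exists g : hom y x, g \oc f = idm x /\ f \oc g = idm y.

Record functor (C D : category) := Functor {
  fob :> C -> D;
  fmap : forall x y : C, hom x y -> hom (fob x) (fob y);
  fmap1 : forall x : C, fmap (idm x) = idm (fob x);
  fmapM : forall (x y z : C) (g : hom y z) (f : hom x y),
    fmap (g \oc f) = fmap g \oc fmap f }.

Arguments fmap {C D} F {x y} f : rename.

Definition fid (C : category) : functor C C :=
  @Functor C C (fun x => x) (fun x y f => f)
    (fun x => erefl) (fun x y z g f => erefl).

Definition fcomp (C D E : category) (G : functor D E) (F : functor C D) :
  functor C E.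
Proof.
refine (@Functor C E (fun x => G (F x)) (fun x y f => fmap G (fmap F f)) _ _).
- by move=> x; rewrite !fmap1.
- by move=> x y z g f; rewrite !fmapM.
Defined.

Notation "G \of F" := (fcomp G F) (at level 50, left associativity) : cat_scope.

Record nattrans (C D : category) (F G : functor C D) := NatTrans {
  ntc :> forall x : C, hom (F x) (G x);
  ntc_nat : forall (x y : C) (f : hom x y),
    fmap G f \oc ntc x = ntc y \oc fmap F f }.

Definition is_natiso (C D : category) (F G : functor C D) (a : nattrans F G) :=
  forall x : C, is_iso (a x).

Record adjunction (C D : category) (L : functor C D) (R : functor D C) :=
  Adjunction {
    adj_unit : nattrans (fid C) (R \of L);
    adj_counit : nattrans (L \of R) (fid D);
    adj_triL : forall c : C, adj_counit (L c) \oc fmap L (adj_unit c) = idm (L c);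
    adj_triR : forall d : D, fmap R (adj_counit d) \oc adj_unit (R d) = idm (R d)
  }.

Definition is_adjoint_equivalence (C D : category) (L : functor C D)
    (R : functor D C) (adj : adjunction L R) : Prop :=
  is_natiso (adj_unit adj) /\ is_natiso (adj_counit adj).

Definition equivalent (C D : category) : Prop :=
  exists (F : functor C D) (G : functor D C)
         (a : nattrans (fid C) (G \of F)) (b : nattrans (F \of G) (fid D)),
    is_natiso a /\ is_natiso b.

Definition full_sub (C : category) (P : C -> Prop) : category :=
  @Category {x : C | P x} (fun x y => hom (sval x) (sval y))
    (fun x => idm (sval x)) (fun x y z g f => g \oc f)
    (fun x y z t => @compA C _ _ _ _)
    (fun x y => @comp1m C _ _) (fun x y => @compm1 C _ _).

Definition full_incl (C : category) (P : C -> Prop) : functor (full_sub P) C :=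
  @Functor (full_sub P) C (fun x => sval x) (fun x y f => f)
    (fun x => erefl) (fun x y z g f => erefl).

Record graph := Graph {
  nodes : Type;
  arcs : Type;
  src : arcs -> nodes;
  tgt : arcs -> nodes }.

Record gmor (X Y : graph) := GMor {
  gm0 : nodes X -> nodes Y;
  gm1 : arcs X -> arcs Y;
  gm_src : forall a, src (gm1 a) = gm0 (src a);
  gm_tgt : forall a, tgt (gm1 a) = gm0 (tgt a) }.

Lemma gmor_eq (X Y : graph) (f g : gmor X Y) :
  gm0 f = gm0 g -> gm1 f = gm1 g -> f = g.
Proof.
case: f g => f0 f1 fs ft [g0 g1 gs gt] /= e0 e1.
subst g0 g1; congr GMor; exact: Prop_irrelevance.
Qed.

Definition gid (X : graph) : gmor X X :=
  @GMor X X id id (fun a => erefl) (fun a => erefl).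

Definition gcomp (X Y Z : graph) (g : gmor Y Z) (f : gmor X Y) : gmor X Z.
Proof.
refine (@GMor X Z (fun x => gm0 g (gm0 f x)) (fun a => gm1 g (gm1 f a)) _ _).
- by move=> a; rewrite !gm_src.
- by move=> a; rewrite !gm_tgt.
Defined.

Definition Gph : category.
Proof.
refine (@Category graph gmor gid gcomp _ _ _).
- by move=> x y z t h g f; apply: gmor_eq.
- by move=> x y f; apply: gmor_eq.
- by move=> x y f; apply: gmor_eq.
Defined.

(* Z/n is rendered as 'I_n with the cyclic successor ordS; unlike 'Z_n this
   has n elements also for n = 1. *)
Definition cycle_graph (n : nat) : Gph := @Graph 'I_n 'I_n (@ordS n) id.

Definition cycles (n : nat) (X : Gph) : Type := @hom Gph (cycle_graph n) X.

Definition cycles_map (n : nat) (X Y : Gph) (f : hom X Y) :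
  cycles n X -> cycles n Y := fun c => f \oc c.

Definition acyclic (X Y : Gph) (f : hom X Y) : Prop :=
  forall n : nat, 0 < n -> bijective (cycles_map (n := n) f).

Definition surjecting (X Y : Gph) (f : hom X Y) : Prop :=
  forall (x : nodes X) (b : arcs Y), src b = gm0 f x ->
    exists a : arcs X, src a = x /\ gm1 f a = b.

Record nset := NSetObj { ncar :> Type; nact : ncar -> ncar }.

Record nsmor (S T : nset) := NSMor {
  nsf :> S -> T;
  nsf_act : forall x, nsf (nact x) = nact (nsf x) }.

Lemma nsmor_eq (S T : nset) (f g : nsmor S T) : nsf f = nsf g -> f = g.
Proof.
case: f g => f fe [g ge] /= e; subst g; congr NSMor; exact: Prop_irrelevance.
Qed.

Definition nsid (S : nset) : nsmor S S := @NSMor S S id (fun x => erefl).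

Definition nscomp (S T U : nset) (g : nsmor T U) (f : nsmor S T) : nsmor S U.
Proof.
by refine (@NSMor S U (fun x => g (f x)) _) => x; rewrite !nsf_act.
Defined.

Definition NSet : category.
Proof.
refine (@Category nset nsmor nsid nscomp _ _ _).
- by move=> x y z t h g f; apply: nsmor_eq.
- by move=> x y f; apply: nsmor_eq.
- by move=> x y f; apply: nsmor_eq.
Defined.

Definition periodic (S : NSet) (x : S) : Prop :=
  exists2 n : nat, 0 < n & iter n (@nact S) x = x.

Definition ZSet : category :=
  full_sub (fun S : NSet => bijective (@nact S)).

Definition cZSet : category :=
  full_sub (fun S : ZSet => forall x : ncar (sval S), periodic x).

Definition iota : functor cZSet ZSet := full_incl _.

Lemma periodic_act (S : NSet) (x : S) : periodic x -> periodic (nact x).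
Proof. by move=> [n n0 xn]; exists n => //; rewrite -iterSr iterS xn. Qed.

Lemma periodic_map (S T : NSet) (f : hom S T) (x : S) :
  periodic x -> periodic (f x).
Proof.
have fi n : f (iter n (@nact S) x) = iter n (@nact T) (f x).
  by elim: n => //= n <-; rewrite nsf_act.
by move=> [n n0 xn]; exists n => //; rewrite -fi xn.
Qed.

Definition periodic_part (S : NSet) : NSet :=
  @NSetObj {x : S | periodic x}
    (fun x => exist _ (nact (sval x)) (periodic_act (svalP x))).

Lemma periodic_part_bij (S : ZSet) :
  bijective (@nact (periodic_part (sval S))).
Proof.
case: S => S [g gK Kg] /=.
have pg (x : S) : periodic x -> periodic (g x).
  move=> [n n0 xn]; exists n => //.
  by apply: (can_inj gK); rewrite -iterS iterSr Kg.
exists (fun x : periodic_part S => exist _ (g (sval x)) (pg _ (svalP x))) => x;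
  apply: sval_eq => /=; [exact: gK | exact: Kg].
Qed.

Lemma periodic_partP (S : NSet) (x : periodic_part S) : periodic x.
Proof.
have vi n : sval (iter n (@nact (periodic_part S)) x)
            = iter n (@nact S) (sval x).
  by elim: n => //= n ->.
have [n n0 xn] := svalP x.
by exists n => //; apply: sval_eq; rewrite vi.
Qed.

Definition j_obj (S : ZSet) : cZSet :=
  exist _ (exist _ (periodic_part (sval S)) (periodic_part_bij S))
    (@periodic_partP (sval S)).

Definition j_map (S T : ZSet) (f : hom S T) : hom (j_obj S) (j_obj T).
Proof.
refine (@NSMor (periodic_part (sval S)) (periodic_part (sval T))
  (fun x => exist _ (nsf f (sval x)) (periodic_map f (svalP x))) _).
by move=> x; apply: sval_eq => /=; rewrite nsf_act.
Defined.

Definition j : functor ZSet cZSet.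
Proof.
refine (@Functor ZSet cZSet j_obj j_map _ _).
- by move=> x; apply: nsmor_eq; apply/funext => y; apply: sval_eq.
- move=> x y z g f; apply: nsmor_eq; apply/funext => u.
  exact: sval_eq.
Defined.

Definition G_obj (S : ZSet) : Gph :=
  @Graph (sval S) (sval S) (@nact (sval S)) id.

Definition G_map (S T : ZSet) (f : hom S T) : hom (G_obj S) (G_obj T).
Proof.
refine (@GMor (G_obj S) (G_obj T) (nsf f) (nsf f) _ _) => x //=.
by rewrite nsf_act.
Defined.

Definition G : functor ZSet Gph.
Proof.
by refine (@Functor ZSet Gph G_obj G_map _ _) => *; apply: gmor_eq.
Defined.

Definition shift (m : int) : int := (m + 1)%R.

Lemma shift_bij : bijective shift.
Proof.
by exists (fun m : int => (m - 1)%R) => m; rewrite /shift ?GRing.addrK ?GRing.subrK.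
Qed.

Definition Zint : ZSet := exist _ (@NSetObj int shift) shift_bij.

Definition line_graph : Gph := G Zint.

Definition shift_mor : @hom ZSet Zint Zint :=
  @NSMor (sval Zint) (sval Zint) shift (fun m => erefl).

(* The carrier is [hom line_graph X], unfolded because the universe of the
   homs of an arbitrary category is too large for a carrier. *)
Definition H_nset (X : Gph) : NSet :=
  @NSetObj (gmor line_graph X)
    (fun h => (h : hom line_graph X) \oc fmap G shift_mor).

Lemma H_bij (X : Gph) : bijective (@nact (H_nset X)).
Proof.
have [g gK Kg] := shift_bij.
have eg (m : int) : g (shift m) = shift (g m) by rewrite gK Kg.
pose g_mor : @hom ZSet Zint Zint := @NSMor (sval Zint) (sval Zint) g eg.
have sg : shift_mor \oc g_mor = idm Zint.
  by apply: nsmor_eq; apply/funext => m /=; exact: Kg.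
have gs : g_mor \oc shift_mor = idm Zint.
  by apply: nsmor_eq; apply/funext => m /=; exact: gK.
have K (u v : @hom ZSet Zint Zint) (h : hom line_graph X) :
    u \oc v = idm Zint -> (h \oc fmap G u) \oc fmap G v = h.
  by move=> uv; rewrite -compA -fmapM uv fmap1 compm1.
by exists (fun h : H_nset X => (h : hom line_graph X) \oc fmap G g_mor) => h; apply: K.
Qed.

Definition H_obj (X : Gph) : ZSet := exist _ (H_nset X) (H_bij X).

Definition H_map (X Y : Gph) (f : hom X Y) : hom (H_obj X) (H_obj Y).
Proof.
refine (@NSMor (H_nset X) (H_nset Y) (fun h => f \oc (h : hom line_graph X)) _) => h.
exact: (@compA Gph).
Defined.

Definition H : functor Gph ZSet.
Proof.
refine (@Functor Gph ZSet H_obj H_map _ _).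
- by move=> X; apply: nsmor_eq; apply/funext => h; exact: (@comp1m Gph).
- move=> X Y Z g f; apply: nsmor_eq; apply/funext => h.
  by symmetry; exact: (@compA Gph).
Defined.

(* A diagram is indexed by the arcs of a small graph;
   this covers diagrams on a small category C, whose (co)cones are those on
   the underlying graph of C. *)

Record diagram (J : graph) (C : category) := Diagram {
  dob : nodes J -> C;
  dar : forall a : arcs J, hom (dob (src a)) (dob (tgt a)) }.

Definition is_cone (J : graph) (C : category) (D : diagram J C) (x : C)
    (p : forall i : nodes J, hom x (dob D i)) : Prop :=
  forall a : arcs J, dar D a \oc p (src a) = p (tgt a).

Definition is_cocone (J : graph) (C : category) (D : diagram J C) (x : C)
    (q : forall i : nodes J, hom (dob D i) x) : Prop :=
  forall a : arcs J, q (tgt a) \oc dar D a = q (src a).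

Definition complete (C : category) : Prop :=
  forall (J : graph) (D : diagram J C),
  exists (x : C) (p : forall i, hom x (dob D i)), is_cone p /\
    forall (y : C) (q : forall i, hom y (dob D i)), is_cone q ->
      exists! u : hom y x, forall i, p i \oc u = q i.

Definition cocomplete (C : category) : Prop :=
  forall (J : graph) (D : diagram J C),
  exists (x : C) (p : forall i, hom (dob D i) x), is_cocone p /\
    forall (y : C) (q : forall i, hom (dob D i) y), is_cocone q ->
      exists! u : hom x y, forall i, u \oc p i = q i.

Definition mclass (C : category) := forall x y : C, hom x y -> Prop.

Definition mcap (C : category) (K K' : mclass C) : mclass C :=
  fun x y f => K x y f /\ K' x y f.

Definition weakly_orth (C : category) (a b x y : C) (l : hom a b) (r : hom x y) :=
  forall (u : hom a x) (v : hom b y), r \oc u = v \oc l ->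
    exists d : hom b x, d \oc l = u /\ r \oc d = v.

Definition left_orth (C : category) (K : mclass C) : mclass C :=
  fun a b l => forall (x y : C) (r : hom x y), K x y r -> weakly_orth l r.

Definition right_orth (C : category) (K : mclass C) : mclass C :=
  fun x y r => forall (a b : C) (l : hom a b), K a b l -> weakly_orth l r.

Record is_wfs (C : category) (K K' : mclass C) : Prop := IsWfs {
  wfs_fact : forall (x y : C) (f : hom x y),
    exists (z : C) (l : hom x z) (r : hom z y),
      K x z l /\ K' z y r /\ r \oc l = f;
  wfs_left : forall (x y : C) (f : hom x y), K x y f <-> left_orth K' f;
  wfs_right : forall (x y : C) (f : hom x y), K' x y f <-> right_orth K f }.

Record three_for_two (C : category) (W : mclass C) : Prop := ThreeForTwo {
  tft_comp : forall (x y z : C) (f : hom x y) (g : hom y z),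
    W _ _ f -> W _ _ g -> W _ _ (g \oc f);
  tft_left : forall (x y z : C) (f : hom x y) (g : hom y z),
    W _ _ f -> W _ _ (g \oc f) -> W _ _ g;
  tft_right : forall (x y z : C) (f : hom x y) (g : hom y z),
    W _ _ g -> W _ _ (g \oc f) -> W _ _ f }.

Record model_data := ModelData {
  mcat :> category;
  cof : mclass mcat;
  fib : mclass mcat;
  weq : mclass mcat }.

Record is_model_category (M : model_data) : Prop := IsModelCategory {
  mc_complete : complete M;
  mc_cocomplete : cocomplete M;
  mc_weq : three_for_two (@weq M);
  mc_wfs1 : is_wfs (mcap (@cof M) (@weq M)) (@fib M);
  mc_wfs2 : is_wfs (@cof M) (mcap (@fib M) (@weq M)) }.

Definition Gph_model : model_data :=
  @ModelData Gph (left_orth (mcap surjecting acyclic)) surjecting acyclic.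

Definition cZSet_model : model_data :=
  @ModelData cZSet (fun x y f => True) (fun x y f => True) (@is_iso cZSet).

(* The localization C[W^-1] by generators and relations: generated by the morphisms of C and formal
   inverses of those in W; a morphism is an equivalence class of words,
   represented as a predicate on words. *)

Section Localization.
Variables (C : category) (W : mclass C).

Inductive word : C -> C -> Type :=
| wd_of x y (f : hom x y) : word x y
| wd_inv x y (w : hom x y) (Ww : W w) : word y x
| wd_comp x y z (g : word y z) (f : word x y) : word x z.

Inductive weqv : forall x y : C, word x y -> word x y -> Prop :=
| weqv_refl x y (f : word x y) : weqv f f
| weqv_sym x y (f g : word x y) : weqv f g -> weqv g f
| weqv_trans x y (f g h : word x y) : weqv f g -> weqv g h -> weqv f h
| weqv_comp x y z (g g' : word y z) (f f' : word x y) :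
    weqv g g' -> weqv f f' -> weqv (wd_comp g f) (wd_comp g' f')
| weqv_assoc x y z t (h : word z t) (g : word y z) (f : word x y) :
    weqv (wd_comp h (wd_comp g f)) (wd_comp (wd_comp h g) f)
| weqv_1w x y (f : word x y) : weqv (wd_comp (wd_of (idm y)) f) f
| weqv_w1 x y (f : word x y) : weqv (wd_comp f (wd_of (idm x))) f
| weqv_of x y z (g : hom y z) (f : hom x y) :
    weqv (wd_of (g \oc f)) (wd_comp (wd_of g) (wd_of f))
| weqv_invl x y (w : hom x y) (Ww : W w) :
    weqv (wd_comp (wd_inv Ww) (wd_of w)) (wd_of (idm x))
| weqv_invr x y (w : hom x y) (Ww : W w) :
    weqv (wd_comp (wd_of w) (wd_inv Ww)) (wd_of (idm y)).

Definition loc_hom (x y : C) : Type :=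
  {P : word x y -> Prop | exists f, P = weqv f}.

Definition wclass (x y : C) (f : word x y) : loc_hom x y :=
  exist _ (weqv f) (ex_intro _ f erefl).

Lemma wclass_eq (x y : C) (f g : word x y) :
  wclass f = wclass g <-> weqv f g.
Proof.
split=> [/(congr1 sval) /= -> | fg]; first exact: weqv_refl.
apply: sval_eq => /=; apply/funext => h; apply/propext; split.
  by apply: weqv_trans; apply: weqv_sym.
exact: weqv_trans.
Qed.

Lemma wclass_surj (x y : C) (P : loc_hom x y) : exists f, P = wclass f.
Proof. by case: P => P [f Pf]; exists f; apply: sval_eq. Qed.

Lemma loc_comp_subproof (x y z : C) (Q : loc_hom y z) (P : loc_hom x y) :
  exists h, (fun k => exists g f,
    sval Q g /\ sval P f /\ weqv (wd_comp g f) k) = weqv h.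
Proof.
have [g ->] := wclass_surj Q; have [f ->] := wclass_surj P.
exists (wd_comp g f); apply/funext => k; apply/propext => /=; split.
  move=> [g' [f' [gg' [ff' /(weqv_trans _)]]]]; apply.
  exact: weqv_comp.
by move=> gfk; exists g, f; do ![split=> //]; apply: weqv_refl.
Qed.

Definition loc_comp (x y z : C) (Q : loc_hom y z) (P : loc_hom x y) :
  loc_hom x z := exist _ _ (loc_comp_subproof Q P).

Lemma loc_compE (x y z : C) (g : word y z) (f : word x y) :
  loc_comp (wclass g) (wclass f) = wclass (wd_comp g f).
Proof.
apply: sval_eq => /=; apply/funext => k; apply/propext; split.
  move=> [g' [f' [gg' [ff' /(weqv_trans _)]]]]; apply.
  exact: weqv_comp.
by move=> gfk; exists g, f; do ![split=> //]; apply: weqv_refl.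
Qed.

Definition localization : category.
Proof.
refine (@Category C loc_hom (fun x => wclass (wd_of (idm x))) loc_comp _ _ _).
- move=> x y z t h g f.
  have [h' ->] := wclass_surj h; have [g' ->] := wclass_surj g.
  have [f' ->] := wclass_surj f.
  by rewrite !loc_compE; apply/wclass_eq; apply: weqv_assoc.
- move=> x y f; have [f' ->] := wclass_surj f.
  by rewrite loc_compE; apply/wclass_eq; apply: weqv_1w.
- move=> x y f; have [f' ->] := wclass_surj f.
  by rewrite loc_compE; apply/wclass_eq; apply: weqv_w1.
Defined.

Definition loc_functor : functor C localization.
Proof.
refine (@Functor C localization (fun x => x) (fun x y f => wclass (wd_of f)) _ _).
- by [].
- move=> x y z g f; rewrite [RHS]loc_compE.
  by apply/wclass_eq; apply: weqv_of.
Defined.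

End Localization.

Definition Ho (M : model_data) : category := localization (@weq M).

Definition gamma (M : model_data) : functor M (Ho M) := loc_functor (@weq M).

(* The derived functors are Kan extensions along gamma: the left derived functor
   is terminal among functors over F, the right one initial under F. *)

Definition is_left_derived (M : model_data) (D : category) (F : functor M D)
    (F' : functor (Ho M) D) (a : nattrans (F' \of gamma M) F) : Prop :=
  forall (K : functor (Ho M) D) (b : nattrans (K \of gamma M) F),
    exists! c : nattrans K F', forall x : M, a x \oc c (gamma M x) = b x.

Definition is_right_derived (M : model_data) (D : category) (F : functor M D)
    (F' : functor (Ho M) D) (a : nattrans F (F' \of gamma M)) : Prop :=
  forall (K : functor (Ho M) D) (b : nattrans F (K \of gamma M)),
    exists! c : nattrans F' K, forall x : M, c (gamma M x) \oc a x = b x.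

Record is_quillen_adjunction (A B : model_data) (L : functor A B)
    (R : functor B A) (adj : adjunction L R) : Prop := IsQuillenAdjunction {
  qa_dom : is_model_category A;
  qa_cod : is_model_category B;
  qa_cof : forall (x y : A) (f : hom x y), cof f -> cof (fmap L f);
  qa_acof : forall (x y : A) (f : hom x y),
    cof f /\ weq f -> cof (fmap L f) /\ weq (fmap L f) }.

(* The total derived functors L', R' of an adjunction (L, R), with the
   adjunction L' -| R' induced by that of L -| R: its unit and counit are
   tied to those of (L, R) by the last two fields. *)
Record derived_adjunction (A B : model_data) (L : functor A B)
    (R : functor B A) (adj : adjunction L R) := DerivedAdjunction {
  dL : functor (Ho A) (Ho B);
  dL_map : nattrans (dL \of gamma A) (gamma B \of L);
  dL_derived : is_left_derived dL_map;
  dR : functor (Ho B) (Ho A);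
  dR_map : nattrans (gamma A \of R) (dR \of gamma B);
  dR_derived : is_right_derived dR_map;
  dadj : adjunction dL dR;
  dadj_unit : forall a : A,
    fmap dR (dL_map a) \oc adj_unit dadj (gamma A a)
    = dR_map (L a) \oc fmap (gamma A) (adj_unit adj a);
  dadj_counit : forall b : B,
    adj_counit dadj (gamma B b) \oc fmap dL (dR_map b)
    = fmap (gamma B) (adj_counit adj b) \oc dL_map (R b) }.

(* The derived adjunction is unique up to unique isomorphism, hence the
   existential quantifier. *)
Definition is_quillen_equivalence (A B : model_data) (L : functor A B)
    (R : functor B A) (adj : adjunction L R) : Prop :=
  is_quillen_adjunction adj /\
  exists d : derived_adjunction adj, is_adjoint_equivalence (dadj d).

Definition Giota : functor cZSet Gph := G \of iota.

Definition jH : functor Gph cZSet := j \of H.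

(* Main.v *)
From mathcomp Require Import all_boot ssralg ssrint boolp.
Require Import Defs.

Set Implicit Arguments.
Unset Strict Implicit.
Unset Printing Implicit Defensive.

Local Open Scope cat_scope.

(* The functor G iota is fully faithful and left adjoint to jH, so cZSet is coreflective in
   Gph and inherits its limits and colimits. The cycle graph C_n is G iota (Z/n), and the
   Z/n generate cZSet; hence, by transposition, jH inverts the acyclic morphisms and the
   counit is acyclic. Both functors therefore preserve weak equivalences, their derived
   functors are induced on the localizations, and the unit and counit become invertible.

   In Gph, every f : X -> Y becomes surjecting after attaching free trees to X; this
   creates no cycles and lifts against all surjecting morphisms. For the other
   factorization, first add all the cycles of Y to X, next identify as little as needed for
   the map to Y to be injective on cycles, and then attach trees. *)

Lemma inj_surj_bij (T U : Type) (f : T -> U) :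
  injective f -> (forall y, exists x, f x = y) -> bijective f.
Proof.
move=> finj fsur; pose g y := sval (cid (fsur y)).
have fK y : f (g y) = y := svalP (cid (fsur y)).
by exists g => [x|//]; apply: finj; rewrite fK.
Qed.

Lemma bij_surj (T U : Type) (f : T -> U) :
  bijective f -> forall y, exists x, f x = y.
Proof. by move=> [g _ gK] y; exists (g y). Qed.

(** * Categories, adjunctions and localizations *)

Lemma is_iso_id (C : category) (x : C) : is_iso (idm x).
Proof. by exists (idm x); rewrite comp1m. Qed.

Lemma is_iso_fmap (C D : category) (F : functor C D) (x y : C) (f : hom x y) :
  is_iso f -> is_iso (fmap F f).
Proof. by move=> [g [gf fg]]; exists (fmap F g); rewrite -!fmapM gf fg !fmap1. Qed.

Lemma is_iso_comp (C : category) (x y z : C) (f : hom x y) (g : hom y z) :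
  is_iso f -> is_iso g -> is_iso (g \oc f).
Proof.
move=> [f' [f'f ff']] [g' [g'g gg']]; exists (f' \oc g'); split.
  by rewrite -compA (compA g') g'g comp1m.
by rewrite -compA (compA f) ff' comp1m.
Qed.

Lemma is_iso_3for2 (C : category) : three_for_two (@is_iso C).
Proof.
split=> x y z f g; first exact: is_iso_comp.
- move=> [f' [f'f ff']] gf_iso; rewrite -(compm1 g) -ff' compA.
  by apply: is_iso_comp gf_iso; exists f.
- move=> [g' [g'g gg']] gf_iso; rewrite -(comp1m f) -g'g -compA.
  by apply: is_iso_comp gf_iso _; exists g.
Qed.

Lemma natiso_inv (C D : category) (F G : functor C D) (a : nattrans F G) :
  is_natiso a ->
  exists2 b : nattrans G F, is_natiso b &
    forall x, b x \oc a x = idm _ /\ a x \oc b x = idm _.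
Proof.
move=> a_iso; pose b x := sval (cid (a_iso x)).
have [bK Kb] : (forall x, b x \oc a x = idm _) /\ (forall x, a x \oc b x = idm _).
  by split=> x; have [] := svalP (cid (a_iso x)).
have b_nat x y (f : hom x y) : fmap F f \oc b x = b y \oc fmap G f.
  rewrite -[fmap G f]compm1 -(Kb x) (compA (fmap G f)) ntc_nat.
  by rewrite 2!compA bK comp1m.
by exists (NatTrans b_nat) => x; [exists (a x) | split].
Qed.

(** * Weak factorization systems of the trivial model structure *)

Section TrivialFactorizations.
Variable C : category.
Let every : mclass C := fun _ _ _ => True.

(** A filler of the square from [f] to itself with identity sides is an inverse of [f]. *)
Lemma is_iso_left_orth (x y : C) (f : hom x y) :
  is_iso f <-> left_orth every f.
Proof.
split=> [[g [gf fg]] a b r _ u v ru | /(_ _ _ f I (idm x) (idm y))].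
  exists (u \oc g); rewrite -compA gf compm1; split=> //.
  by rewrite compA ru -compA fg compm1.
by rewrite compm1 comp1m => /(_ erefl) [g [gf fg]]; exists g.
Qed.

Lemma is_iso_right_orth (x y : C) (f : hom x y) :
  is_iso f <-> right_orth every f.
Proof.
split=> [[g [gf fg]] a b l _ u v ru | /(_ _ _ f I (idm x) (idm y))].
  exists (g \oc v); rewrite compA fg comp1m; split=> //.
  by rewrite -compA -ru compA gf comp1m.
by rewrite compm1 comp1m => /(_ erefl) [g [gf fg]]; exists g.
Qed.

Lemma is_wfs_iso_every : is_wfs (mcap every (@is_iso C)) every.
Proof.
split=> x y f.
- by exists x, (idm x), f; do !split; rewrite ?compm1 //; apply: is_iso_id.
- by rewrite -is_iso_left_orth; split=> [[]|].
- split=> // _ a b l [_ /is_iso_left_orth]; exact.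
Qed.

Lemma is_wfs_every_iso : is_wfs every (mcap every (@is_iso C)).
Proof.
split=> x y f.
- by exists y, f, (idm y); do !split; rewrite ?comp1m //; apply: is_iso_id.
- split=> // _ a b l [_ /is_iso_right_orth]; exact.
- by rewrite -is_iso_right_orth; split=> [[]|].
Qed.

End TrivialFactorizations.

Section Orthogonality.
Variables (C : category) (K : mclass C).

Lemma left_orth_comp (x y z : C) (f : hom x y) (g : hom y z) :
  left_orth K f -> left_orth K g -> left_orth K (g \oc f).
Proof.
move=> Kf Kg a b r Kr u v; rewrite compA => /(Kf _ _ _ Kr) [d [df rd]].
have [e [eg re]] := Kg _ _ _ Kr _ _ rd.
by exists e; rewrite compA eg.
Qed.

(* The retract argument: if f = r l lifts against r, it is a retract of l. *)
Lemma left_orth_retract (x y z : C) (f : hom x y) (l : hom x z) (r : hom z y) :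
  r \oc l = f -> left_orth K l -> weakly_orth f r -> left_orth K f.
Proof.
move=> rl Kl /(_ l (idm y)); rewrite comp1m => /(_ rl) [d [df rd]].
move=> a b p Kp u v puv.
have [|e [el pe]] := Kl _ _ p Kp u (v \oc r); first by rewrite -compA rl.
by exists (e \oc d); rewrite -compA df el compA pe -compA rd compm1.
Qed.

End Orthogonality.

Section Adjunctions.
Variables (C D : category) (L : functor C D) (R : functor D C).
Variable adj : adjunction L R.

(* The unit and counit with their types in beta-normal form: rewriting does not see
   through [fid] and [\of] in the implicit arguments of [comp]. *)
Definition eta (c : C) : hom c (R (L c)) := adj_unit adj c.
Definition eps (d : D) : hom (L (R d)) d := adj_counit adj d.

Lemma eps_eta_L (c : C) : eps (L c) \oc fmap L (eta c) = idm (L c).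
Proof. exact: adj_triL. Qed.

Lemma R_eps_eta (d : D) : fmap R (eps d) \oc eta (R d) = idm (R d).
Proof. exact: adj_triR. Qed.

Definition adj_lower (c : C) (d : D) (a : hom c (R d)) : hom (L c) d :=
  eps d \oc fmap L a.

Definition adj_raise (c : C) (d : D) (k : hom (L c) d) : hom c (R d) :=
  fmap R k \oc eta c.

Lemma eta_nat (x y : C) (f : hom x y) :
  fmap R (fmap L f) \oc eta x = eta y \oc f.
Proof. exact: (ntc_nat (adj_unit adj) f). Qed.

Lemma eps_nat (x y : D) (f : hom x y) :
  f \oc eps x = eps y \oc fmap L (fmap R f).
Proof. exact: (ntc_nat (adj_counit adj) f). Qed.

Lemma adj_lowerK (c : C) (d : D) (a : hom c (R d)) :
  adj_raise (adj_lower a) = a.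
Proof.
by rewrite /adj_raise fmapM -compA eta_nat compA R_eps_eta comp1m.
Qed.

Lemma adj_raiseK (c : C) (d : D) (k : hom (L c) d) :
  adj_lower (adj_raise k) = k.
Proof.
by rewrite /adj_lower fmapM compA -eps_nat -compA eps_eta_L compm1.
Qed.

Lemma adj_lower_comp (c : C) (x y : D) (p : hom x y) (a : hom c (R x)) :
  p \oc adj_lower a = adj_lower (fmap R p \oc a).
Proof. by rewrite /adj_lower fmapM compA eps_nat -compA. Qed.

Lemma adj_raise_comp (c c' : C) (x : D) (f : hom c c') (k : hom (L c') x) :
  adj_raise (k \oc fmap L f) = adj_raise k \oc f.
Proof. by rewrite /adj_raise fmapM -!compA eta_nat. Qed.

Lemma adj_lower_comp_l (c c' : C) (x : D) (f : hom c c') (a : hom c' (R x)) :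
  adj_lower a \oc fmap L f = adj_lower (a \oc f).
Proof. by rewrite /adj_lower fmapM compA. Qed.

Lemma adj_raise_comp_r (c : C) (x y : D) (p : hom x y) (k : hom (L c) x) :
  fmap R p \oc adj_raise k = adj_raise (p \oc k).
Proof. by rewrite /adj_raise fmapM compA. Qed.

(** Transposition along the adjunction. When [L c] is a cycle graph, the left side says that [p] is
    bijective on cycles of that length. *)
Lemma adj_bij (c : C) (x y : D) (p : hom x y) :
  bijective (fun k : hom (L c) x => p \oc k) <->
  bijective (fun a : hom c (R x) => fmap R p \oc a).
Proof.
split=> [] [q pK qK].
- exists (fun b => adj_raise (q (adj_lower b))) => a.
    by rewrite -adj_lower_comp pK adj_lowerK.
  by rewrite adj_raise_comp_r qK adj_lowerK.
- exists (fun k => adj_lower (q (adj_raise k))) => a.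
    by rewrite -adj_raise_comp_r pK adj_raiseK.
  by rewrite adj_lower_comp qK adj_raiseK.
Qed.

(** The transposed square is filled using the inverse of [fmap R p]. *)
Lemma adj_weakly_orth (c c' : C) (f : hom c c') (x y : D) (p : hom x y) :
  is_iso (fmap R p) -> weakly_orth (fmap L f) p.
Proof.
move=> [q [qp pq]] u v puv; exists (adj_lower (q \oc adj_raise v)); split.
  rewrite adj_lower_comp_l -compA -adj_raise_comp -puv -adj_raise_comp_r.
  by rewrite compA qp comp1m adj_raiseK.
by rewrite adj_lower_comp compA pq comp1m adj_raiseK.
Qed.

Section Coreflective.
Hypothesis eta_iso : forall c : C, is_iso (eta c).

(** A triangle identity makes [fmap R (eps d)] a left inverse of the invertible [eta (R d)]. *)
Lemma coreflective_R_eps (d : D) : is_iso (fmap R (eps d)).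
Proof.
have [q [qe eq]] := eta_iso (R d); exists (eta (R d)); split; last exact: R_eps_eta.
suff -> : fmap R (eps d) = q by [].
by rewrite -[LHS]compm1 -eq compA R_eps_eta comp1m.
Qed.

Lemma coreflective_eps_bij (c : C) (d : D) :
  bijective (fun k : hom (L c) (L (R d)) => eps d \oc k).
Proof.
apply/adj_bij; have [q [qe eq]] := coreflective_R_eps d.
by exists (fun a => q \oc a) => a; rewrite compA ?qe ?eq comp1m.
Qed.

Lemma coreflective_faithful (c c' : C) : injective (@fmap _ _ L c c').
Proof.
move=> f g fg; have [q [qe _]] := eta_iso c'.
by rewrite -[f]comp1m -[g]comp1m -qe -!compA -!eta_nat fg.
Qed.

Lemma adj_lower_eta (c c' : C) (f : hom c c') :
  adj_lower (eta c' \oc f) = fmap L f.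
Proof. by rewrite /adj_lower fmapM compA eps_eta_L comp1m. Qed.

(** The limit is [R] of a limit of the image diagram, with projections corrected by the inverse of
    the unit. *)
Lemma coreflective_complete : complete D -> complete C.
Proof.
have [theta _ thetaK] := natiso_inv (eta_iso : is_natiso (adj_unit adj)).
rewrite /= in thetaK.
move=> cD J Dg.
have [x [p [px xu]]] := cD J (@Diagram J D (fun i => L (dob Dg i)) (fun a => fmap L (dar Dg a))).
exists (R x), (fun i => theta _ \oc fmap R (p i)); split=> [a|y r ry].
  by rewrite -px fmapM /= !compA; congr (_ \oc _); apply: (ntc_nat theta).
have [|u [ur uu]] := xu (L y) (fun i => fmap L (r i)).
  by move=> a /=; rewrite -fmapM ry.
exists (adj_raise u); split=> [i|v vr].
  rewrite -compA adj_raise_comp_r ur /adj_raise eta_nat compA.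
  by case: (thetaK (dob Dg i)) => -> _; rewrite comp1m.
rewrite (uu (adj_lower v)) ?adj_lowerK // => i.
rewrite adj_lower_comp -adj_lower_eta -vr 2!compA.
by case: (thetaK (dob Dg i)) => _ ->; rewrite comp1m.
Qed.

(* The colimit x of L Dg already lies in the image of L: the cocone factors through eps x,
   which gives a section of eps x. *)
Lemma coreflective_cocomplete : cocomplete D -> cocomplete C.
Proof.
move=> cD J Dg.
have [x [p [px xu]]] := cD J (@Diagram J D (fun i => L (dob Dg i)) (fun a => fmap L (dar Dg a))).
pose q i : hom (dob Dg i) (R x) := adj_raise (p i).
have qx a : q (tgt a) \oc dar Dg a = q (src a) by rewrite -adj_raise_comp px.
have [|s [sp _]] := xu (L (R x)) (fun i => fmap L (q i)).
  by move=> a /=; rewrite -fmapM qx.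
have es : eps x \oc s = idm x.
  have [w [_ wu]] := xu x p px.
  rewrite -(wu (idm x)) => [|i]; last exact: comp1m.
  by apply/esym/wu => i; rewrite -compA sp; apply: adj_raiseK.
have se : s \oc eps x = idm _.
  apply: (bij_inj (coreflective_eps_bij _ _)).
  by rewrite compA es comp1m compm1.
exists (R x), q; split=> // y r ry.
have [|u [ur uu]] := xu (L y) (fun i => fmap L (r i)).
  by move=> a /=; rewrite -fmapM ry.
have [e [ee ee']] := eta_iso y.
exists (e \oc fmap R u); split=> [i|v vr].
  by rewrite -compA adj_raise_comp_r ur /adj_raise eta_nat compA ee comp1m.
apply: coreflective_faithful.
have vs : u = fmap L v \oc s by apply: uu => i; rewrite -compA sp -fmapM vr.
rewrite -[RHS]compm1 -se compA -vs -[LHS]adj_lower_eta compA ee' comp1m.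
by rewrite /adj_lower -eps_nat.
Qed.

End Coreflective.
End Adjunctions.

(** * Universal property of the localization, for functors and natural transformations *)

Section LocalizationLift.
Variables (C D : category) (W : mclass C) (F : functor C D).
Hypothesis F_iso : forall (x y : C) (w : hom x y), W w -> is_iso (fmap F w).

Fixpoint word_eval (x y : C) (f : word W x y) : hom (F x) (F y) :=
  match f with
  | wd_of _ _ f => fmap F f
  | wd_inv _ _ w Ww => sval (cid (F_iso Ww))
  | wd_comp _ _ _ g f => word_eval g \oc word_eval f
  end.

Lemma word_eval_weqv (x y : C) (f g : word W x y) :
  weqv f g -> word_eval f = word_eval g.
Proof.
elim=> {x y f g} //=.
- by move=> x y f g h _ -> _ ->.
- by move=> x y z g g' f f' _ -> _ ->.
- by move=> *; rewrite compA.
- by move=> *; rewrite fmap1 comp1m.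
- by move=> *; rewrite fmap1 compm1.
- by move=> *; rewrite fmapM.
- by move=> x y w Ww; rewrite fmap1; case: (svalP (cid (F_iso Ww))).
- by move=> x y w Ww; rewrite fmap1; case: (svalP (cid (F_iso Ww))).
Qed.

Definition loc_eval (x y : C) (P : loc_hom W x y) : hom (F x) (F y) :=
  word_eval (sval (cid (wclass_surj P))).

Lemma loc_evalE (x y : C) (f : word W x y) : loc_eval (wclass f) = word_eval f.
Proof.
rewrite /loc_eval; case: cid => g /= /wclass_eq fg.
exact/esym/word_eval_weqv.
Qed.

(** The object map is [fob F] itself, so that [loc_liftE] can be stated without transport. *)
Definition loc_lift : functor (localization W) D.
Proof.
refine (@Functor (localization W) D (fob F) loc_eval _ _).
- by move=> x; rewrite loc_evalE /= fmap1.
- move=> x y z g f; have [g' ->] := wclass_surj g; have [f' ->] := wclass_surj f.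
  by rewrite [_ \oc _]loc_compE !loc_evalE.
Defined.

Lemma loc_liftE (x y : C) (f : hom x y) :
  fmap loc_lift (fmap (loc_functor W) f) = fmap F f.
Proof. exact: loc_evalE. Qed.

End LocalizationLift.

Lemma loc_functor_iso (C : category) (W : mclass C) (x y : C) (w : hom x y) :
  W x y w -> is_iso (fmap (loc_functor W) w).
Proof.
move=> Ww; exists (wclass (wd_inv Ww)).
split; rewrite [LHS]loc_compE; apply/wclass_eq; [exact: weqv_invl | exact: weqv_invr].
Qed.

(** Gives naturality at a formal inverse from naturality at the morphism that it inverts. *)
Lemma nat_square_inv (C D : category) (K K' : functor C D) (x y : C)
    (m : hom x y) (i : hom y x) (a : hom (K x) (K' x)) (b : hom (K y) (K' y)) :
  i \oc m = idm x -> m \oc i = idm y ->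
  fmap K' m \oc a = b \oc fmap K m -> fmap K' i \oc b = a \oc fmap K i.
Proof.
move=> im mi sq; rewrite -[LHS]compm1 -(fmap1 K) -mi fmapM compA -(compA _ b) -sq.
by rewrite compA -fmapM im fmap1 comp1m.
Qed.

Section LocalizationNaturality.
Variables (C D : category) (W : mclass C) (K K' : functor (localization W) D).
Variable a : nattrans (K \of loc_functor W) (K' \of loc_functor W).

Lemma loc_nat (x y : localization W) (f : hom x y) :
  fmap K' f \oc a x = a y \oc fmap K f.
Proof.
have [f' ->] := wclass_surj f; elim: f' => {x y f}.
- by move=> x y f; apply: (ntc_nat a f).
- move=> x y w Ww.
  apply: (@nat_square_inv (localization W) D K K' x y (wclass (wd_of W w)) _ (a x) (a y));
    last exact: (ntc_nat a w).
    by rewrite [LHS]loc_compE; apply/wclass_eq/weqv_invl.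
  by rewrite [LHS]loc_compE; apply/wclass_eq/weqv_invr.
- move=> x y z g IHg f IHf.
  have -> : wclass (wd_comp g f) = (wclass g : @hom (localization W) _ _) \oc wclass f.
    by rewrite [RHS]loc_compE.
  by rewrite !fmapM -compA IHf compA IHg compA.
Qed.

Definition loc_nattrans : nattrans K K' := NatTrans loc_nat.

End LocalizationNaturality.

Lemma nattrans_eq (C D : category) (F G : functor C D) (a b : nattrans F G) :
  (forall x, a x = b x) -> a = b.
Proof.
case: a b => a na [b nb] /= ab.
have {}ab : a = b by apply: functional_extensionality_dep.
by subst b; congr NatTrans; apply: Prop_irrelevance.
Qed.

(** * Limits and colimits of graphs *)

Lemma gph_complete : complete Gph.
Proof.
move=> J D.
pose N := {x : forall i, nodes (dob D i) |
  forall a, gm0 (dar D a) (x (src a)) = x (tgt a)}.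
pose A := {b : forall i, arcs (dob D i) |
  forall a, gm1 (dar D a) (b (src a)) = b (tgt a)}.
have sP (b : A) a :
    gm0 (dar D a) (src (sval b (src a))) = src (sval b (tgt a)).
  by rewrite -gm_src (svalP b).
have tP (b : A) a :
    gm0 (dar D a) (tgt (sval b (src a))) = tgt (sval b (tgt a)).
  by rewrite -gm_tgt (svalP b).
pose L : Gph := @Graph N A (fun b => exist _ (fun i => src (sval b i)) (sP b))
  (fun b => exist _ (fun i => tgt (sval b i)) (tP b)).
pose p i : hom L (dob D i) := @GMor L (dob D i)
  (fun x => sval x i) (fun b => sval b i) (fun=> erefl) (fun=> erefl).
exists L, p; split=> [a|Y q qD].
  by apply: gmor_eq; apply/funext => x /=; rewrite (svalP x).
have q0 y a : gm0 (dar D a) (gm0 (q (src a)) y) = gm0 (q (tgt a)) y.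
  by rewrite -qD.
have q1 y a : gm1 (dar D a) (gm1 (q (src a)) y) = gm1 (q (tgt a)) y.
  by rewrite -qD.
pose u0 y : nodes L := exist _ (fun i => gm0 (q i) y) (q0 y).
pose u1 b : arcs L := exist _ (fun i => gm1 (q i) b) (q1 b).
have us b : src (u1 b) = u0 (src b).
  by apply: sval_eq; apply: functional_extensionality_dep => i; apply: gm_src.
have ut b : tgt (u1 b) = u0 (tgt b).
  by apply: sval_eq; apply: functional_extensionality_dep => i; apply: gm_tgt.
exists (GMor us ut); split=> [i|v vq]; first exact: gmor_eq.
apply: gmor_eq; apply/funext => y; apply: sval_eq;
  by apply: functional_extensionality_dep => i /=; rewrite -vq.
Qed.

Section Quotient.
Variables (T : Type) (E : T -> T -> Prop).
Hypothesis E_equiv : forall x y, E x y <-> E x = E y.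

Definition quotient : Type := {S : T -> Prop | exists x, S = E x}.

Definition class_of (x : T) : quotient := exist _ (E x) (ex_intro _ x erefl).

Definition repr_of (S : quotient) : T := sval (cid (svalP S)).

Lemma repr_ofK S : class_of (repr_of S) = S.
Proof. by apply: sval_eq; rewrite /= -(svalP (cid (svalP S))). Qed.

Lemma class_of_eq x y : class_of x = class_of y <-> E x y.
Proof.
split=> [/(congr1 sval) /E_equiv // | /E_equiv xy]; exact: sval_eq.
Qed.

Lemma repr_class_of x : E (repr_of (class_of x)) x.
Proof. by apply/class_of_eq; rewrite repr_ofK. Qed.

End Quotient.

(** * Joint coimages: the quotient by what all morphisms of a class identify *)

Section JointCoimage.
Variables (X : graph) (P : forall Q : graph, gmor X Q -> Prop).

(** [Prop] is impredicative, so quantifying over all graphs still yields a quotient that is an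
    ordinary graph. *)
Definition node_rel (x y : nodes X) : Prop :=
  forall (Q : graph) (q : gmor X Q), P q -> gm0 q x = gm0 q y.

Definition arc_rel (a b : arcs X) : Prop :=
  forall (Q : graph) (q : gmor X Q), P q -> gm1 q a = gm1 q b.

Lemma node_rel_equiv x y : node_rel x y <-> node_rel x = node_rel y.
Proof.
split=> [xy | ->] //; apply/funext => z; apply/propext.
by split=> h Q q Pq; rewrite -h // xy.
Qed.

Lemma arc_rel_equiv a b : arc_rel a b <-> arc_rel a = arc_rel b.
Proof.
split=> [ab | ->] //; apply/funext => c; apply/propext.
by split=> h Q q Pq; rewrite -h // ab.
Qed.

(** Endpoints are computed on a representative arc; the choice is immaterial because every morphism
    of the class commutes with [src] and [tgt]. *)
Definition coimage : graph := @Graph (quotient node_rel) (quotient arc_rel)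
  (fun A => class_of node_rel (src (repr_of A)))
  (fun A => class_of node_rel (tgt (repr_of A))).

Definition coimage_map : gmor X coimage.
Proof.
refine (@GMor X coimage (class_of node_rel) (class_of arc_rel) _ _) => a;
  apply/(class_of_eq node_rel_equiv) => Q q Pq;
  have qa := repr_class_of arc_rel_equiv a _ _ Pq;
  by rewrite -?gm_src -?gm_tgt qa.
Defined.

Definition coimage_lift (Q : graph) (q : gmor X Q) : P q -> gmor coimage Q.
Proof.
move=> Pq; refine (@GMor coimage Q (fun A => gm0 q (repr_of A))
  (fun A => gm1 q (repr_of A)) _ _) => A.
  by rewrite gm_src (repr_class_of node_rel_equiv _ _ _ Pq).
by rewrite gm_tgt (repr_class_of node_rel_equiv _ _ _ Pq).
Defined.

Lemma coimage_liftK (Q : graph) (q : gmor X Q) (Pq : P q) :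
  gcomp (coimage_lift Pq) coimage_map = q.
Proof.
apply: gmor_eq; apply/funext => x.
  exact: (repr_class_of node_rel_equiv x _ _ Pq).
exact: (repr_class_of arc_rel_equiv x _ _ Pq).
Qed.

Lemma coimage_node_surj (z : nodes coimage) : exists x, gm0 coimage_map x = z.
Proof. by exists (repr_of z); apply: repr_ofK. Qed.

Lemma coimage_arc_surj (c : arcs coimage) : exists a, gm1 coimage_map a = c.
Proof. by exists (repr_of c); apply: repr_ofK. Qed.

Lemma coimage_map_epi (Q : graph) (u v : gmor coimage Q) :
  gcomp u coimage_map = gcomp v coimage_map -> u = v.
Proof.
move=> uv; apply: gmor_eq; apply/funext => z.
  by have [x <-] := coimage_node_surj z; apply: (congr1 (fun f => gm0 f x) uv).
by have [a <-] := coimage_arc_surj z; apply: (congr1 (fun f => gm1 f a) uv).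
Qed.

Lemma coimage_node_eq x y :
  gm0 coimage_map x = gm0 coimage_map y <-> node_rel x y.
Proof. exact: class_of_eq node_rel_equiv x y. Qed.

Lemma coimage_arc_eq a b :
  gm1 coimage_map a = gm1 coimage_map b <-> arc_rel a b.
Proof. exact: class_of_eq arc_rel_equiv a b. Qed.

End JointCoimage.

(** The colimit is the quotient of the disjoint sum by the identifications common to all cocones, so
    no equivalence relation has to be generated. *)
Lemma gph_cocomplete : cocomplete Gph.
Proof.
move=> J D.
pose S : Gph := @Graph {i : nodes J & nodes (dob D i)} {i : nodes J & arcs (dob D i)}
  (fun b => existT _ (tag b) (src (tagged b)))
  (fun b => existT _ (tag b) (tgt (tagged b))).
pose inj i : hom (dob D i) S := @GMor (dob D i) S
  (fun x => existT _ i x) (fun a => existT _ i a) (fun=> erefl) (fun=> erefl).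
pose P Q (q : gmor S Q) := is_cocone (D := D) (fun i => (q : @hom Gph S Q) \oc inj i).
pose p i : hom (dob D i) (coimage P : Gph) := (coimage_map P : @hom Gph S (coimage P)) \oc inj i.
exists (coimage P), p; split=> [a|Y q qD].
  apply: gmor_eq; apply/funext => x.
    apply/(coimage_node_eq P) => Q q Pq.
    exact: (congr1 (fun f => gm0 f x) (Pq a)).
  apply/(coimage_arc_eq P) => Q q Pq.
  exact: (congr1 (fun f => gm1 f x) (Pq a)).
pose q' : gmor S Y := @GMor S Y (fun x => gm0 (q (tag x)) (tagged x))
  (fun b => gm1 (q (tag b)) (tagged b)) (fun b => gm_src _ _) (fun b => gm_tgt _ _).
have qE i : (q' : @hom Gph S Y) \oc inj i = q i by apply: gmor_eq.
have Pq : P Y q' by move=> a; rewrite !qE.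
exists (coimage_lift Pq); split=> [i|v vq].
  by rewrite -qE -[X in _ = X \oc _](coimage_liftK Pq); apply: gmor_eq.
apply: (@coimage_map_epi S P); rewrite coimage_liftK.
by apply: gmor_eq; apply/funext => -[i x] /=; rewrite -vq.
Qed.

(** * Acyclic and surjecting morphisms *)

Definition cycle_injective (X Y : Gph) (f : hom X Y) : Prop :=
  forall n : nat, 0 < n -> injective (cycles_map (n := n) f).

Lemma acyclic_3for2 : three_for_two acyclic.
Proof.
have cyc (x y z : Gph) (f : hom x y) (g : hom y z) n :
    cycles_map (n := n) (g \oc f) = cycles_map g \o cycles_map f.
  by apply/funext => c; symmetry; apply: (@compA Gph).
split=> x y z f g fW gW n n0; move: (fW n n0) (gW n n0).
- by rewrite cyc => *; apply: bij_comp.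
- rewrite cyc => -[f' fK f'K] gf; apply: (eq_bij (bij_comp gf (Bijective f'K fK))).
  by move=> c /=; rewrite f'K.
- rewrite cyc => -[g' gK g'K] gf; apply: (eq_bij (bij_comp (Bijective g'K gK) gf)).
  by move=> c /=; rewrite gK.
Qed.

(** The hypotheses give [r \oc l = f], so [f] is a retract of [l], and bijections are stable under
    retracts. *)
Lemma acyclic_retract_l (x y z : Gph) (f : hom x y) (l : hom x z)
    (r : hom z y) (d : hom y z) :
  d \oc f = l -> r \oc d = idm y -> acyclic l -> acyclic f.
Proof.
move=> df rd lW n n0; apply: inj_surj_bij => [c c' fc|c].
  by apply: (bij_inj (lW n n0)); rewrite /cycles_map -df -!(@compA Gph) [f \oc c]fc.
have [c' lc] := bij_surj (lW n n0) (d \oc c).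
by exists c'; rewrite /cycles_map -[f]comp1m -rd -!compA (compA d) df
  [l \oc _]lc compA rd comp1m.
Qed.

Lemma acyclic_retract_r (x y z : Gph) (f : hom x y) (l : hom x z)
    (r : hom z y) (d : hom z x) :
  d \oc l = idm x -> f \oc d = r -> acyclic r -> acyclic f.
Proof.
move=> dl fd rW n n0; apply: inj_surj_bij => [c c' fc|c].
  rewrite -[c]comp1m -[c']comp1m -dl -!compA; congr (d \oc _).
  apply: (bij_inj (rW n n0)); rewrite /cycles_map -fd -!compA !(compA d) dl.
  by rewrite !comp1m.
have [c' rc] := bij_surj (rW n n0) c.
by exists (d \oc c'); rewrite /cycles_map compA fd.
Qed.

Lemma surjecting_retract (x y z : Gph) (f : hom x y) (l : hom x z)
    (r : hom z y) (d : hom z x) :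
  r \oc l = f -> d \oc l = idm x -> f \oc d = r -> surjecting r -> surjecting f.
Proof.
move=> rl dl fd rS v b fb.
have [|a [av ra]] := rS (gm0 l v) b; first by rewrite fb -rl.
exists (gm1 d a); split; last by rewrite -ra -fd.
by rewrite gm_src av; apply: (congr1 (fun h => gm0 h v) dl).
Qed.

(** * Attaching trees *)

Section Trees.
Variables (X Y : Gph) (f : hom X Y).

(* A node [grow b t] is the end of a new copy of the arc [b] starting at [t]. *)
Inductive tree : nodes Y -> Type :=
| root (x : nodes X) : tree (gm0 f x)
| grow (b : arcs Y) (t : tree (src b)) : tree (tgt b).

Definition tree_at (x : nodes X) : {y & tree y} := existT _ _ (root x).

Definition tree_arc : Type := (arcs X + {b : arcs Y & tree (src b)})%type.

Definition forest : Gph := @Graph {y & tree y} tree_arc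
  (fun c => match c with
    | inl a => tree_at (src a)
    | inr (existT b t) => existT _ (src b) t
    end)
  (fun c => match c with
    | inl a => tree_at (tgt a)
    | inr (existT b t) => existT _ (tgt b) (grow t)
    end).

Definition forest_incl : hom X forest := @GMor X forest tree_at inl
  (fun=> erefl) (fun=> erefl).

Definition forest_proj : hom forest Y.
Proof.
refine (@GMor forest Y (fun t => tag t)
  (fun c => match c with inl a => gm1 f a | inr c => tag c end) _ _).
  by move=> [a|[b t]] //=; rewrite gm_src.
by move=> [a|[b t]] //=; rewrite gm_tgt.
Defined.

Lemma forest_fact : forest_proj \oc forest_incl = f.
Proof. exact: gmor_eq. Qed.

Lemma forest_proj_surjecting : surjecting forest_proj.
Proof.
move=> [y t] b /= by_; subst y.
by exists (inr (existT _ b t)).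
Qed.

(** The trees are free, so a filler is built by recursion: each [grow] chooses an arc of [A] that
    lifts the required arc of [B]. *)
Lemma forest_incl_left_orth : left_orth surjecting forest_incl.
Proof.
move=> A B p pS u v puv.
have puv0 x : gm0 p (gm0 u x) = gm0 v (tree_at x).
  exact: (congr1 (fun h => gm0 h x) puv).
have step n b : src b = gm0 p n -> {a | src a = n /\ gm1 p a = b}.
  by move=> bn; apply/cid/pS.
have arcP b (t : tree (src b)) n : gm0 p n = gm0 v (existT _ _ t) ->
    src (gm1 v (inr (existT _ b t))) = gm0 p n.
  by move=> ->; rewrite gm_src.
have endP b (t : tree (src b)) n (e : gm0 p n = gm0 v (existT _ _ t)) :
    gm0 p (tgt (sval (step _ _ (arcP b t n e)))) = gm0 v (existT _ _ (grow t)).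
  by rewrite -gm_tgt (svalP (step _ _ _)).2 gm_tgt.
(* The recursion returns a node with the proof that it lies over the prescribed node, because the
   choice of the next arc depends on that proof. *)
pose lift := fix lift y (t : tree y) : {n | gm0 p n = gm0 v (existT _ y t)} :=
  match t with
  | root x => exist _ (gm0 u x) (puv0 x)
  | grow b t => exist _ _ (endP b t _ (svalP (lift _ t)))
  end.
pose d0 (z : nodes forest) := sval (lift _ (tagged z)).
pose d1 (c : arcs forest) := match c with
  | inl a => gm1 u a
  | inr (existT b t) => sval (step _ _ (arcP b t _ (svalP (lift _ t))))
  end.
have ds c : src (d1 c) = d0 (src c).
  case: c => [a|[b t]] /=; first exact: gm_src.
  by case: (svalP (step _ _ (arcP b t _ (svalP (lift _ t))))).
have dt c : tgt (d1 c) = d0 (tgt c).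
  by case: c => [a|[b t]] //=; apply: gm_tgt.
exists (GMor ds dt); split; first exact: gmor_eq.
apply: gmor_eq; apply/funext; first by move=> [y t]; apply: svalP (lift _ t).
move=> [a|[b t]] /=.
- exact: (congr1 (fun h => gm1 h a) puv).
- by case: (svalP (step _ _ (arcP b t _ (svalP (lift _ t))))).
Qed.

Fixpoint depth y (t : tree y) : nat :=
  match t with root _ => 0 | grow _ t => (depth t).+1 end.

(** A partial inverse of [tree_at], whose injectivity thus needs no inversion in the dependent
    family [tree]. *)
Definition tree_root (z : nodes forest) : option (nodes X) :=
  match tagged z with root x => Some x | grow _ _ => None end.

Lemma tree_at_inj : injective tree_at.
Proof. by move=> x y /(congr1 tree_root) []. Qed.

(* Depth does not decrease along an arc and strictly increases along a new one, so a cycle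
   contains no new arc. *)
Lemma forest_cycle n (c : cycles n forest) (i : 'I_n) : exists a, gm1 c i = inl a.
Proof.
pose h i := depth (tagged (gm0 c i)).
(* The arc [k] of a cycle graph runs from [ordS k] to [k], so the smaller depth is the one at
   [ordS k]. *)
have hle k : h (ordS k) <= h k ?= iff ~~ (if gm1 c k is inr _ then true else false).
  have := gm_src c k; have := gm_tgt c k; rewrite /= /h => <- <-.
  case: (gm1 c k) => [a|[b t]] /=; first exact/leqif_refl.
  by split; rewrite ?leqnSn // eqn_leq ltnn andbF.
(* Both sides have the same sum over the cycle because [ordS] is a permutation, so every inequality
   is an equality. *)
have := leqif_sum (fun k (_ : true) => hle k).
rewrite -(reindex_inj (P := predT) (F := h) (bij_inj (ordS_bij n))) /=.
case=> _; rewrite eqxx => /esym/forallP/(_ i) /=.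
by case: (gm1 c i) => // a _; exists a.
Qed.

Lemma forest_incl_acyclic : acyclic forest_incl.
Proof.
move=> n n0; apply: inj_surj_bij => [c c' cc'|c].
  apply: gmor_eq; apply/funext => i.
    exact/tree_at_inj/(congr1 (fun h => gm0 h i) cc').
  by have [] := congr1 (fun h => gm1 h i) cc'.
pose a i := sval (cid (forest_cycle c i)).
have ca i : gm1 c i = inl (a i) := svalP (cid (forest_cycle c i)).
(* In a cycle graph [tgt] is the identity, so the arcs of a cycle determine its nodes. *)
have c0 i : gm0 c i = tree_at (tgt (a i)).
  by have := gm_tgt c i; rewrite ca /= => <-.
have as_ i : src (a i) = tgt (a (ordS i)).
  by apply: tree_at_inj; rewrite -c0; have := gm_src c i; rewrite ca.
exists (@GMor (cycle_graph n) X (fun i => tgt (a i)) a as_ (fun=> erefl)).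
by apply: gmor_eq; apply/funext => i /=; rewrite ?ca ?c0.
Qed.

End Trees.

(** * Acyclic cofibrations and fibrations of graphs *)

Lemma left_orth_sub (C : category) (K K' : mclass C) (x y : C) (f : hom x y) :
  (forall a b (g : hom a b), K' _ _ g -> K _ _ g) -> left_orth K f -> left_orth K' f.
Proof. by move=> KK' Kf a b r /KK'; apply: Kf. Qed.

(** Acyclic cofibrations turn out to be exactly the morphisms that lift against all surjecting ones;
    this and the claim on fibrations are retract arguments on the forest factorization. *)
Lemma gph_wfs1 :
  is_wfs (mcap (left_orth (mcap surjecting acyclic)) acyclic) surjecting.
Proof.
have trivial_cof X Y (f : @hom Gph X Y) :
    left_orth (mcap surjecting acyclic) f /\ acyclic f <-> left_orth surjecting f.
  have lr := forest_fact f; have lo := @forest_incl_left_orth X Y f.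
  have lW := @forest_incl_acyclic X Y f; have rS := @forest_proj_surjecting X Y f.
  split=> [[fo fW]|fo].
    apply: (left_orth_retract lr lo); apply: fo; split=> //.
    by apply: (tft_left acyclic_3for2 lW); rewrite lr.
  split; first by apply: left_orth_sub fo => ? ? ? [].
  (* Lifting against the projection exhibits [f] as a retract of the acyclic [forest_incl f]. *)
  have [|d [df rd]] := fo _ _ _ rS (forest_incl f) (idm Y).
    by rewrite lr comp1m.
  exact: acyclic_retract_l df rd lW.
split=> X Y f.
- exists (forest f), (forest_incl f), (forest_proj f); split.
    exact/trivial_cof/forest_incl_left_orth.
  split; [exact: forest_proj_surjecting | exact: forest_fact].
- exact: trivial_cof.
- split=> [fS A B l /trivial_cof lo | fo]; first exact: lo.
  have lr := forest_fact f.
  have [||d [dl fd]] := fo _ _ (forest_incl f) _ (idm X) (forest_proj f).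
  + exact/trivial_cof/forest_incl_left_orth.
  + by rewrite compm1 lr.
  exact: surjecting_retract lr dl fd (@forest_proj_surjecting _ _ f).
Qed.

(** * Merging cycles *)

Section MergeCycles.
Variables (X Y : Gph) (f : hom X Y).

Definition cycle_factor (Q : graph) (q : gmor X Q) : Prop :=
  exists r : @hom Gph Q Y, cycle_injective r /\ r \oc (q : @hom Gph X Q) = f.

(** The initial factorization of [f] whose second factor is injective on cycles. *)
Definition merged : Gph := coimage cycle_factor.
Definition merge : hom X merged := coimage_map cycle_factor.

(** Two cycles of [merged] with the same image in [Y] have the same image in every admissible [Q],
    and the morphisms to these [Q] are jointly injective. *)
Lemma merge_fact : exists r : hom merged Y, cycle_injective r /\ r \oc merge = f.
Proof.
have fF : cycle_factor f.
  by exists (idm Y); split=> [n n0 c c'|]; rewrite /cycles_map !comp1m.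
exists (coimage_lift fF); split; last exact: coimage_liftK.
move=> n n0 c c' cc'.
have lift_cc' Q (q : gmor X Q) (qF : cycle_factor q) :
    (coimage_lift qF : @hom Gph merged Q) \oc c = (coimage_lift qF : @hom Gph merged Q) \oc c'.
  have [r [rI rq]] := qF; apply: (rI n n0).
  suff rE : r \oc (coimage_lift qF : @hom Gph merged Q) = coimage_lift fF.
    by rewrite /cycles_map !compA rE.
  apply: (coimage_map_epi (P := cycle_factor)); rewrite coimage_liftK.
  by rewrite -[RHS]rq -[in RHS](coimage_liftK qF); apply: gmor_eq.
apply: gmor_eq; apply/funext => i.
  have [x xc] := coimage_node_surj (gm0 c i); have [x' xc'] := coimage_node_surj (gm0 c' i).
  rewrite -xc -xc'; apply/(coimage_node_eq cycle_factor) => Q q qF.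
  rewrite -(coimage_liftK qF) /= -[class_of _ x]/(gm0 merge x) -[class_of _ x']/(gm0 merge x').
  rewrite xc xc'; exact: (congr1 (fun h => gm0 h i) (lift_cc' _ _ qF)).
have [x xc] := coimage_arc_surj (gm1 c i); have [x' xc'] := coimage_arc_surj (gm1 c' i).
rewrite -xc -xc'; apply/(coimage_arc_eq cycle_factor) => Q q qF.
rewrite -(coimage_liftK qF) /= -[class_of _ x]/(gm1 merge x) -[class_of _ x']/(gm1 merge x').
rewrite xc xc'; exact: (congr1 (fun h => gm1 h i) (lift_cc' _ _ qF)).
Qed.

(* The pullback of [p] along [v] receives [X] and is still injective on cycles over [Y];
   hence [merge] identifies no more than [X -> pullback] does. *)
Lemma merge_left_orth : left_orth (mcap surjecting acyclic) merge.
Proof.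
move=> A B p [_ pW] u v puv.
have [r [rI rf]] := merge_fact.
have puv0 x : gm0 v (gm0 merge x) = gm0 p (gm0 u x).
  exact: (congr1 (fun h => gm0 h x) (esym puv)).
have puv1 x : gm1 v (gm1 merge x) = gm1 p (gm1 u x).
  exact: (congr1 (fun h => gm1 h x) (esym puv)).
pose N := {z : nodes merged * nodes A | gm0 v z.1 = gm0 p z.2}.
pose E := {c : arcs merged * arcs A | gm1 v c.1 = gm1 p c.2}.
have sP (c : E) : gm0 v (src (sval c).1) = gm0 p (src (sval c).2).
  by rewrite -!gm_src (svalP c).
have tP (c : E) : gm0 v (tgt (sval c).1) = gm0 p (tgt (sval c).2).
  by rewrite -!gm_tgt (svalP c).
pose Q : Gph := @Graph N E
  (fun c => exist _ (src (sval c).1, src (sval c).2) (sP c))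
  (fun c => exist _ (tgt (sval c).1, tgt (sval c).2) (tP c)).
pose pr1 : hom Q merged := @GMor Q merged
  (fun z => (sval z).1) (fun c => (sval c).1) (fun=> erefl) (fun=> erefl).
pose pr2 : hom Q A := @GMor Q A
  (fun z => (sval z).2) (fun c => (sval c).2) (fun=> erefl) (fun=> erefl).
have prE : v \oc pr1 = p \oc pr2.
  by apply: gmor_eq; apply/funext => z /=; rewrite (svalP z).
pose q0 x : nodes Q := exist _ (gm0 merge x, gm0 u x) (puv0 x).
pose q1 a : arcs Q := exist _ (gm1 merge a, gm1 u a) (puv1 a).
have qs a : src (q1 a) = q0 (src a).
  by apply: sval_eq; rewrite -[RHS]/(gm0 merge _, gm0 u _) -!gm_src.
have qt a : tgt (q1 a) = q0 (tgt a).
  by apply: sval_eq; rewrite -[RHS]/(gm0 merge _, gm0 u _) -!gm_tgt.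
pose q : hom X Q := GMor qs qt.
(* A cycle of the pullback is a pair of cycles: the first is fixed by injectivity of [r] on cycles,
   then the second by that of [p]. *)
have qF : cycle_factor q.
  exists (r \oc pr1); split; last by rewrite -rf; apply: gmor_eq.
  move=> n n0 c c'; rewrite /cycles_map -!compA => /(rI n n0) e1.
  have e2 : pr2 \oc c = pr2 \oc c'.
    by apply: (bij_inj (pW n n0)); rewrite /cycles_map !compA -prE -!compA e1.
  apply: gmor_eq; apply/funext => i; apply: sval_eq; apply: injective_projections.
  - exact: (congr1 (fun h => gm0 h i) e1).
  - exact: (congr1 (fun h => gm0 h i) e2).
  - exact: (congr1 (fun h => gm1 h i) e1).
  - exact: (congr1 (fun h => gm1 h i) e2).
pose d : hom merged A := pr2 \oc (coimage_lift qF : @hom Gph merged Q).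
have du : d \oc merge = u.
  by rewrite -compA [_ \oc merge](coimage_liftK qF); apply: gmor_eq.
exists d; split=> //; apply: (coimage_map_epi (P := cycle_factor)).
by rewrite -[LHS]/((p \oc d) \oc merge) -compA du.
Qed.

End MergeCycles.

(** * Periodic sets *)

Lemma iter_periodic (S : NSet) (x : S) n k :
  iter n (@nact S) x = x -> iter (k * n) (@nact S) x = x.
Proof. by move=> xn; elim: k => // k IHk; rewrite mulSn iterD IHk. Qed.

Lemma periodic_nact_bij (S : NSet) :
  (forall x : S, periodic x) -> bijective (@nact S).
Proof.
move=> Sper; apply: inj_surj_bij => [x y xy|y]; last first.
  by have [[//|n] _ yn] := Sper y; exists (iter n (@nact S) y).
have [[//|n] _ xn] := Sper x; have [[//|m] _ ym] := Sper y.
(* The product of the two periods is a common period N; iterating N - 1 more times from the common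
   image returns to both elements. *)
have N_gt0 : 0 < n.+1 * m.+1 by rewrite muln_gt0.
have xN : iter (n.+1 * m.+1) (@nact S) x = x by rewrite mulnC iter_periodic.
have yN : iter (n.+1 * m.+1) (@nact S) y = y by rewrite iter_periodic.
by rewrite -xN -yN -(prednK N_gt0) !iterSr xy.
Qed.

Definition czset_of (S : NSet) (Sper : forall x : S, periodic x) : cZSet :=
  exist _ (exist _ S (periodic_nact_bij Sper)) Sper.

Lemma czset_iso (S T : cZSet) (f : hom S T) : bijective (nsf f) -> is_iso f.
Proof.
move=> [g fK gK].
have ga y : g (nact y) = nact (g y).
  by apply: (can_inj fK); rewrite nsf_act !gK.
exists (NSMor ga : @hom cZSet T S).
by split; apply: nsmor_eq; apply/funext => x; [apply: fK | apply: gK].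
Qed.

Lemma val_iter_ordS n (i : 'I_n) k : iter k (@ordS n) i = (i + k) %% n :> nat.
Proof.
elim: k => [|k IHk] /=; first by rewrite addn0 modn_small.
by rewrite IHk -addn1 modnDml addn1 addnS.
Qed.

Lemma cycle_periodic n (i : @NSetObj 'I_n (@ordS n) : NSet) : periodic i.
Proof.
exists n; first exact: leq_ltn_trans (ltn_ord i).
by apply: val_inj; rewrite /= val_iter_ordS modnDr modn_small.
Qed.

Definition cycle_set (n : nat) : cZSet := czset_of (@cycle_periodic n).

(** The element [x] as a morphism out of Z/n; the equation on [x] is what the wrap-around at the
    last index needs. *)
Definition cycle_elt (S : cZSet) (n : nat) (x : sval (sval S)) :
  iter n (@nact _) x = x -> hom (cycle_set n) S.
Proof.
move=> xn; refine (@NSMor (sval (sval (cycle_set n))) (sval (sval S))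
  (fun i : 'I_n => iter i (@nact _) x) _) => i /=.
rewrite -iterS; have [->|ltin] := eqVneq i.+1 n; first by rewrite modnn xn.
by rewrite modn_small // ltn_neqAle ltin; apply: ltn_ord.
Defined.

Definition cycle_at (S : cZSet) (n : nat) (n0 : 0 < n) (c : hom (cycle_set n) S) :
  sval (sval S) := nsf c (Ordinal n0).

(** For injectivity, elements of periods [n] and [m] are both represented on the cycle of length
    [n * m]; for surjectivity, a preimage is read off from a lifted cycle. *)
Lemma cycle_sets_generate (S T : cZSet) (f : hom S T) :
  (forall n, 0 < n -> bijective (fun c : hom (cycle_set n) S => f \oc c)) ->
  is_iso f.
Proof.
move=> fbij; apply/czset_iso/inj_surj_bij => [x y fxy|y].
  have [n n0 xn] := svalP S x; have [m m0 ym] := svalP S y.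
  have N0 : 0 < n * m by rewrite muln_gt0 n0.
  have yN : iter (n * m) (@nact _) y = y by rewrite iter_periodic.
  have xN : iter (n * m) (@nact _) x = x by rewrite mulnC iter_periodic.
  have fE z k : nsf f (iter k (@nact _) z) = iter k (@nact _) (nsf f z).
    by elim: k => //= k <-; apply: nsf_act.
  have /(bij_inj (fbij _ N0)) : f \oc cycle_elt xN = f \oc cycle_elt yN.
    by apply: nsmor_eq; apply/funext => i; rewrite /= !fE fxy.
  by move=> /(congr1 (cycle_at N0)).
have [n n0 yn] := svalP T y.
have [c fc] := bij_surj (fbij n n0) (cycle_elt yn).
by exists (cycle_at n0 c); apply: (congr1 (cycle_at n0) fc).
Qed.

(** * The adjunction *)

Section Line.
Variable S : ZSet.

Lemma act_inv_subproof :
  exists g : sval S -> sval S, cancel (@nact (sval S)) g /\ cancel g (@nact (sval S)).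
Proof. by case: (svalP S) => g gK Kg; exists g. Qed.

Definition act_inv : sval S -> sval S := sval (cid act_inv_subproof).

Lemma act_invK : cancel act_inv (@nact (sval S)).
Proof. exact: (svalP (cid act_inv_subproof)).2. Qed.

(** [Negz n] is the integer -(n + 1), hence the exponent [n.+1] of the inverse. *)
Definition int_iter (x : sval S) (m : int) : sval S :=
  match m with
  | Posz n => iter n (@nact (sval S)) x
  | Negz n => iter n.+1 act_inv x
  end.

Lemma int_iter_shift x m : int_iter x (shift m) = nact (int_iter x m).
Proof.
case: m => [n|[|n]]; rewrite /shift.
- by rewrite -PoszD addn1.
- by rewrite /= act_invK.
- have -> : (Negz n.+1 + 1)%R = Negz n by rewrite !NegzE -[n.+2]addn1 PoszD GRing.opprD GRing.subrK.
  by rewrite /= act_invK.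
Qed.

Definition line_map (x : sval S) : hom Zint S :=
  @NSMor (sval Zint) (sval S) (int_iter x) (int_iter_shift x).

Lemma line_map_eq (f g : hom Zint S) : nsf f 0%R = nsf g 0%R -> f = g.
Proof.
move=> fg0; apply: nsmor_eq; apply/funext => m.
have nact_inj : injective (@nact (sval S)) := bij_inj (svalP S).
have fs (h : hom Zint S) k : nact (nsf h k) = nsf h (k + 1)%R.
  by rewrite -nsf_act.
elim/int_rec: m => // n IHn.
  by rewrite -addn1 PoszD -!fs IHn.
apply: nact_inj; rewrite !fs -addn1 PoszD GRing.opprD GRing.subrK.
exact: IHn.
Qed.

Lemma line_map_nact x : line_map (nact x) = line_map x \oc shift_mor.
Proof. exact: line_map_eq. Qed.

(** Both target maps are identities, so the arc component of [h] equals its node component, which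
    commutes with the actions by the source condition. *)
Lemma line_gmor (h : gmor line_graph (G S)) : h = fmap G (line_map (gm0 h 0%R)).
Proof.
have h10 m : gm1 h m = gm0 h m by apply: (gm_tgt h m).
have hs m : gm0 h (shift m) = nact (gm0 h m).
  by rewrite -(h10 m); apply/esym/(gm_src h m).
pose h' : hom Zint S := @NSMor (sval Zint) (sval S) (gm0 h) hs.
have <- : h' = line_map (gm0 h 0%R) by apply: line_map_eq.
by apply: gmor_eq => //; apply/funext => m; rewrite h10.
Qed.

End Line.

Definition eta_ZSet (S : ZSet) : hom S (H (G S)).
Proof.
refine (@NSMor (sval S) (H_nset (G S)) (fun x => fmap G (line_map x)) _) => x.
by rewrite line_map_nact; apply: (fmapM G).
Defined.

Definition eta_czset (S : cZSet) : hom S (jH (Giota S)).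
Proof.
refine (@NSMor (sval (sval S)) (periodic_part (H_nset (Giota S)))
  (fun x => exist _ (nsf (eta_ZSet (sval S)) x)
     (periodic_map (eta_ZSet (sval S)) (svalP S x))) _) => x.
by apply: sval_eq; rewrite /= -[LHS]/(nsf (eta_ZSet _) _) nsf_act.
Defined.

(** Evaluation at 0. It respects sources because the shifted line takes at 0 the value of the
    original one at 1. *)
Definition eps_gph (X : Gph) : hom (Giota (jH X)) X.
Proof.
refine (@GMor (Giota (jH X)) X (fun h => gm0 (sval h) 0%R)
  (fun h => gm1 (sval h) 0%R) _ _) => h; [exact: gm_src | exact: gm_tgt].
Defined.

Lemma int_iter_H (X : Gph) (h : sval (sval (jH X))) (m k : int) :
  let hm := sval (int_iter (S := sval (jH X)) h m) in
  gm0 hm k = gm0 (sval h) (k + m)%R /\ gm1 hm k = gm1 (sval h) (k + m)%R.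
Proof.
rewrite /=.
have hS n l : let hm := sval (int_iter (S := sval (jH X)) h n) in
    let hn := sval (int_iter (S := sval (jH X)) h (n + 1)%R) in
    gm0 hn l = gm0 hm (l + 1)%R /\ gm1 hn l = gm1 hm (l + 1)%R.
  by rewrite /= -[(n + 1)%R]/(shift n) int_iter_shift.
elim/int_rec: m k => [|n IHn|n IHn] k; first by rewrite GRing.addr0.
  rewrite -addn1 PoszD; have [-> ->] := hS n k; have [-> ->] := IHn (k + 1)%R.
  by rewrite GRing.addrAC GRing.addrA.
(* For negative exponents the one-step relation is read backwards, at [k - 1]. *)
have [e0 e1] := hS (- n.+1%:Z)%R (k - 1)%R; move: e0 e1.
rewrite GRing.subrK; have -> : (- n.+1%:Z + 1)%R = (- n%:Z)%R.
  by rewrite -addn1 PoszD GRing.opprD GRing.subrK.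
move=> <- <-; have [-> ->] := IHn (k - 1)%R.
by rewrite -GRing.addrA -GRing.opprD -PoszD add1n.
Qed.

Lemma eta_czset_nat (S T : cZSet) (f : hom S T) :
  fmap (jH \of Giota) f \oc eta_czset S = eta_czset T \oc fmap (fid cZSet) f.
Proof.
apply: nsmor_eq; apply/funext => x; apply: sval_eq.
rewrite /= -[LHS]/(fmap G (f : @hom ZSet (sval S) (sval T)) \oc fmap G (line_map x)).
by rewrite -fmapM; congr (fmap G _); apply: line_map_eq.
Qed.

Lemma eps_gph_nat (X Y : Gph) (f : hom X Y) :
  fmap (fid Gph) f \oc eps_gph X = eps_gph Y \oc fmap (Giota \of jH) f.
Proof. exact: gmor_eq. Qed.

Lemma Giota_jH_triL (S : cZSet) :
  eps_gph (Giota S) \oc fmap Giota (eta_czset S) = idm (Giota S).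
Proof. exact: gmor_eq. Qed.

Lemma Giota_jH_triR (X : Gph) :
  fmap jH (eps_gph X) \oc eta_czset (jH X) = idm (jH X).
Proof.
apply: nsmor_eq; apply/funext => h; apply: sval_eq.
apply: gmor_eq; apply/funext => m /=.
  by have [-> _] := int_iter_H h m 0%R; rewrite GRing.add0r.
by have [_ ->] := int_iter_H h m 0%R; rewrite GRing.add0r.
Qed.

Definition Giota_jH : @adjunction cZSet Gph Giota jH :=
  @Adjunction cZSet Gph Giota jH
    (@NatTrans _ _ (fid cZSet) (jH \of Giota) eta_czset eta_czset_nat)
    (@NatTrans _ _ (Giota \of jH) (fid Gph) eps_gph eps_gph_nat)
    Giota_jH_triL Giota_jH_triR.

(** Evaluation at 0 inverts the unit; surjectivity is [line_gmor]. *)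
Lemma eta_czset_iso (S : cZSet) : is_iso (eta Giota_jH S).
Proof.
apply: czset_iso; apply: inj_surj_bij => [x y|h].
  exact: (congr1 (fun h : sval (sval (jH (Giota S))) => gm0 (sval h) 0%R)).
exists (gm0 (sval h) 0%R); apply: sval_eq.
by rewrite [RHS]line_gmor.
Qed.

(** [cycle_graph n] is convertible to [Giota (cycle_set n)], so acyclicity transposes to bijectivity
    on the maps out of each Z/n. *)
Lemma jH_acyclic (X Y : Gph) (f : hom X Y) : acyclic f -> is_iso (fmap jH f).
Proof.
move=> fW; apply: cycle_sets_generate => n n0.
exact/(adj_bij Giota_jH)/(fW n n0).
Qed.

Lemma Giota_left_orth (S T : cZSet) (f : hom S T) :
  left_orth (mcap surjecting acyclic) (fmap Giota f).
Proof. by move=> X Y p [_ /jH_acyclic]; apply: (adj_weakly_orth Giota_jH). Qed.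

Lemma Giota_lift (S : cZSet) (X Y : Gph) (p : hom X Y) :
  acyclic p -> forall v : hom (Giota S) Y, exists u, p \oc u = v.
Proof.
move=> /jH_acyclic [q [qp pq]]; apply: bij_surj; apply/(adj_bij Giota_jH).
by exists (fun a => q \oc a) => a; rewrite compA ?qp ?pq comp1m.
Qed.

Lemma eps_gph_acyclic (X : Gph) : acyclic (eps_gph X).
Proof.
move=> n n0; exact: (coreflective_eps_bij eta_czset_iso (cycle_set n) X).
Qed.

Lemma acyclic_iso (X Y : Gph) (f : hom X Y) : is_iso f -> acyclic f.
Proof.
move=> [g [gf fg]] n n0; exists (cycles_map g) => c;
  by rewrite /cycles_map compA ?gf ?fg comp1m.
Qed.

(** * The model structures *)

Section CopairWithCycles.
Variables (X Y : Gph) (f : hom X Y).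
Let C : Gph := Giota (jH Y).

(** The coproduct of [X] with the coreflection of [Y], through which all cycles of [Y] factor. *)
Definition add_cycles : Gph := @Graph (nodes X + nodes C) (arcs X + arcs C)
  (fun c => match c with inl a => inl (src a) | inr a => inr (src a) end)
  (fun c => match c with inl a => inl (tgt a) | inr a => inr (tgt a) end).

Definition add_cycles_inl : hom X add_cycles :=
  @GMor X add_cycles inl inl (fun=> erefl) (fun=> erefl).

Definition add_cycles_inr : hom C add_cycles :=
  @GMor C add_cycles inr inr (fun=> erefl) (fun=> erefl).

Definition copair (Z : Gph) (u : hom X Z) (v : hom C Z) : hom add_cycles Z.
Proof.
refine (@GMor add_cycles Z
  (fun x => match x with inl x => gm0 u x | inr x => gm0 v x end)
  (fun a => match a with inl a => gm1 u a | inr a => gm1 v a end) _ _).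
  by case=> a; apply: gm_src.
by case=> a; apply: gm_tgt.
Defined.

Lemma add_cycles_inl_left_orth :
  left_orth (mcap surjecting acyclic) add_cycles_inl.
Proof.
move=> A B p [_ pW] u v puv.
have [w pw] := Giota_lift pW (v \oc add_cycles_inr).
exists (copair u w); split; first exact: gmor_eq.
apply: gmor_eq; apply/funext => -[x|x].
- exact: (congr1 (fun h => gm0 h x) puv).
- exact: (congr1 (fun h => gm0 h x) pw).
- exact: (congr1 (fun h => gm1 h x) puv).
- exact: (congr1 (fun h => gm1 h x) pw).
Qed.

Lemma cofibration_factorization : exists (Z : Gph) (l : hom X Z) (r : hom Z Y),
  [/\ left_orth (mcap surjecting acyclic) l, surjecting r, acyclic r & r \oc l = f].
Proof.
have f1l : copair f (eps_gph Y) \oc add_cycles_inl = f by apply: gmor_eq.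
have f1r : copair f (eps_gph Y) \oc add_cycles_inr = eps_gph Y by apply: gmor_eq.
have [r [rI rm]] := merge_fact (copair f (eps_gph Y)).
(* Injectivity on cycles comes from the merging, surjectivity from the added summand [C]. *)
have rW : acyclic r.
  move=> n n0; apply: inj_surj_bij => [|c]; first exact: rI.
  have [c' <-] := bij_surj (eps_gph_acyclic Y n0) c.
  exists (merge (copair f (eps_gph Y)) \oc add_cycles_inr \oc c').
  by rewrite /cycles_map !compA rm f1r.
exists (forest r).
exists (forest_incl r \oc (merge (copair f (eps_gph Y)) \oc add_cycles_inl)).
exists (forest_proj r); split.
- apply: left_orth_comp; last first.
    by apply: left_orth_sub (@forest_incl_left_orth _ _ r) => ? ? ? [].
  apply: left_orth_comp; first exact: add_cycles_inl_left_orth.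
  exact: merge_left_orth.
- exact: forest_proj_surjecting.
- by apply: (tft_left acyclic_3for2 (@forest_incl_acyclic _ _ r)); rewrite forest_fact.
- by rewrite !compA forest_fact rm f1l.
Qed.

End CopairWithCycles.

(** For the right class, lifting against the first factor makes [f] a retract of the second, an
    acyclic fibration. *)
Lemma gph_wfs2 :
  is_wfs (left_orth (mcap surjecting acyclic)) (mcap surjecting acyclic).
Proof.
split=> X Y f.
- have [Z [l [r [lo rS rW lr]]]] := cofibration_factorization f.
  by exists Z, l, r.
- by [].
- split=> [fSW A B l lo | fo]; first exact: lo.
  have [Z [l [r [lo rS rW lr]]]] := cofibration_factorization f.
  have [|d [dl fd]] := fo _ _ l lo (idm X) r; first by rewrite compm1 lr.
  split; first exact: surjecting_retract lr dl fd rS.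
  exact: acyclic_retract_r dl fd rW.
Qed.

Lemma gph_model_category : is_model_category Gph_model.
Proof.
split; [exact: gph_complete | exact: gph_cocomplete | exact: acyclic_3for2
  | exact: gph_wfs1 | exact: gph_wfs2].
Qed.

Lemma czset_model_category : is_model_category cZSet_model.
Proof.
split.
- exact: coreflective_complete eta_czset_iso gph_complete.
- exact: coreflective_cocomplete eta_czset_iso gph_cocomplete.
- exact: is_iso_3for2.
- exact: is_wfs_iso_every.
- exact: is_wfs_every_iso.
Qed.

Lemma Giota_jH_quillen :
  @is_quillen_adjunction cZSet_model Gph_model Giota jH Giota_jH.
Proof.
split; [exact: czset_model_category | exact: gph_model_category | |].
- by move=> S T f _; apply: Giota_left_orth.
- move=> S T f [_ f_iso]; split; first exact: Giota_left_orth.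
  exact/acyclic_iso/is_iso_fmap.
Qed.

(** * Derived functors of homotopical functors *)

Section HomotopicalFunctor.
Variables (M : model_data) (D : category) (F : functor M D).
Hypothesis F_weq : forall (x y : M) (w : hom x y), weq w -> is_iso (fmap F w).

Definition ho_lift : functor (Ho M) D := loc_lift F_weq.

Lemma ho_liftE (x y : M) (f : hom x y) : fmap ho_lift (fmap (gamma M) f) = fmap F f.
Proof. exact: loc_liftE. Qed.

Lemma ho_lift_to_nat (x y : M) (f : hom x y) :
  fmap F f \oc idm (F x) = idm (F y) \oc fmap (ho_lift \of gamma M) f.
Proof. by rewrite [fmap (_ \of _) f]ho_liftE comp1m compm1. Qed.

Definition ho_lift_to : nattrans (ho_lift \of gamma M) F :=
  @NatTrans _ _ (ho_lift \of gamma M) F (fun x => idm (F x)) ho_lift_to_nat.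

Lemma ho_lift_from_nat (x y : M) (f : hom x y) :
  fmap (ho_lift \of gamma M) f \oc idm (F x) = idm (F y) \oc fmap F f.
Proof. by rewrite [fmap (_ \of _) f]ho_liftE comp1m compm1. Qed.

Definition ho_lift_from : nattrans F (ho_lift \of gamma M) :=
  @NatTrans _ _ F (ho_lift \of gamma M) (fun x => idm (F x)) ho_lift_from_nat.

(** Since [gamma M] is the identity on objects, a transformation into [ho_lift] is the same as a
    family natural along [gamma M], and the comparison [ho_lift_to] consists of identities. *)
Lemma ho_lift_left_derived : is_left_derived ho_lift_to.
Proof.
move=> K b.
have b_nat (x y : M) (f : hom x y) :
    fmap (ho_lift \of gamma M) f \oc b x = b y \oc fmap (K \of gamma M) f.
  rewrite [fmap (_ \of _) f]ho_liftE; exact: (ntc_nat b).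
exists (loc_nattrans (@NatTrans _ _ (K \of gamma M) (ho_lift \of gamma M) b b_nat)).
split=> [x|c cb]; first exact: comp1m.
by apply: nattrans_eq => x; rewrite /= -cb; apply: comp1m.
Qed.

Lemma ho_lift_right_derived : is_right_derived ho_lift_from.
Proof.
move=> K b.
have b_nat (x y : M) (f : hom x y) :
    fmap (K \of gamma M) f \oc b x = b y \oc fmap (ho_lift \of gamma M) f.
  rewrite [fmap (ho_lift \of _) f]ho_liftE; exact: (ntc_nat b).
exists (loc_nattrans (@NatTrans _ _ (ho_lift \of gamma M) (K \of gamma M) b b_nat)).
split=> [x|c cb]; first exact: compm1.
by apply: nattrans_eq => x; rewrite /= -cb; apply: compm1.
Qed.

End HomotopicalFunctor.

(** * The derived adjunction when both functors preserve weak equivalences *)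

Section HomotopicalAdjunction.
Variables (A B : model_data) (L : functor A B) (R : functor B A).
Variable adj : adjunction L R.
Hypothesis L_weq : forall (x y : A) (w : hom x y), weq w -> weq (fmap L w).
Hypothesis R_weq : forall (x y : B) (w : hom x y), weq w -> weq (fmap R w).

Lemma gamma_L_weq (x y : A) (w : hom x y) : weq w -> is_iso (fmap (gamma B \of L) w).
Proof. by move=> /L_weq; apply: loc_functor_iso. Qed.

Lemma gamma_R_weq (x y : B) (w : hom x y) : weq w -> is_iso (fmap (gamma A \of R) w).
Proof. by move=> /R_weq; apply: loc_functor_iso. Qed.

Let dL : functor (Ho A) (Ho B) := ho_lift gamma_L_weq.
Let dR : functor (Ho B) (Ho A) := ho_lift gamma_R_weq.

Let dLE (x y : A) (f : hom x y) :
  fmap dL (fmap (gamma A) f) = fmap (gamma B) (fmap L f).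
Proof. exact: (ho_liftE gamma_L_weq f). Qed.

Let dRE (x y : B) (f : hom x y) :
  fmap dR (fmap (gamma B) f) = fmap (gamma A) (fmap R f).
Proof. exact: (ho_liftE gamma_R_weq f). Qed.

Lemma ho_unit_nat (x y : A) (f : hom x y) :
  fmap ((dR \of dL) \of gamma A) f \oc fmap (gamma A) (eta adj x) =
  fmap (gamma A) (eta adj y) \oc fmap (fid (Ho A) \of gamma A) f.
Proof.
rewrite -[fmap (_ \of gamma A) f]/(fmap dR (fmap dL (fmap (gamma A) f))) dLE dRE.
by rewrite -[RHS]/(fmap (gamma A) _ \oc fmap (gamma A) _) -!fmapM eta_nat.
Qed.

Lemma ho_counit_nat (x y : B) (f : hom x y) :
  fmap (fid (Ho B) \of gamma B) f \oc fmap (gamma B) (eps adj x) =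
  fmap (gamma B) (eps adj y) \oc fmap ((dL \of dR) \of gamma B) f.
Proof.
rewrite -[fmap ((_ \of _) \of gamma B) f]/(fmap dL (fmap dR (fmap (gamma B) f))) dRE dLE.
rewrite -[LHS]/(fmap (gamma B) _ \oc fmap (gamma B) _) -fmapM eps_nat.
exact: (fmapM (gamma B)).
Qed.

Definition ho_unit : nattrans (fid (Ho A)) (dR \of dL) :=
  loc_nattrans (@NatTrans _ _ (fid (Ho A) \of gamma A) ((dR \of dL) \of gamma A)
    (fun x => fmap (gamma A) (eta adj x)) ho_unit_nat).

Definition ho_counit : nattrans (dL \of dR) (fid (Ho B)) :=
  loc_nattrans (@NatTrans _ _ ((dL \of dR) \of gamma B) (fid (Ho B) \of gamma B)
    (fun x => fmap (gamma B) (eps adj x)) ho_counit_nat).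

Lemma ho_triL (c : Ho A) : ho_counit (dL c) \oc fmap dL (ho_unit c) = idm (dL c).
Proof.
rewrite -[ho_unit c]/(fmap (gamma A) (eta adj c)) dLE.
by rewrite -[LHS]/(fmap (gamma B) _ \oc fmap (gamma B) _) -fmapM eps_eta_L fmap1.
Qed.

Lemma ho_triR (d : Ho B) : fmap dR (ho_counit d) \oc ho_unit (dR d) = idm (dR d).
Proof.
rewrite -[ho_counit d]/(fmap (gamma B) (eps adj d)) dRE.
by rewrite -[LHS]/(fmap (gamma A) _ \oc fmap (gamma A) _) -fmapM R_eps_eta fmap1.
Qed.

Definition ho_adjunction : adjunction dL dR := Adjunction ho_triL ho_triR.

Lemma ho_adjunction_unit (a : A) :
  fmap dR (ho_lift_to gamma_L_weq a) \oc adj_unit ho_adjunction (gamma A a)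
  = ho_lift_from gamma_R_weq (L a) \oc fmap (gamma A) (adj_unit adj a).
Proof.
rewrite -[ho_lift_to _ a]/(idm (dL a)) fmap1.
by rewrite [LHS]comp1m; apply/esym; apply: comp1m.
Qed.

Lemma ho_adjunction_counit (b : B) :
  adj_counit ho_adjunction (gamma B b) \oc fmap dL (ho_lift_from gamma_R_weq b)
  = fmap (gamma B) (adj_counit adj b) \oc ho_lift_to gamma_L_weq (R b).
Proof.
rewrite -[ho_lift_from _ b]/(idm (dR b)) fmap1.
by rewrite [LHS]compm1; apply/esym; apply: compm1.
Qed.

Definition homotopical_derived_adjunction : derived_adjunction adj :=
  DerivedAdjunction (ho_lift_left_derived gamma_L_weq)
    (ho_lift_right_derived gamma_R_weq) ho_adjunction_unit ho_adjunction_counit.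

Lemma homotopical_quillen_equivalence :
  (forall a, weq (eta adj a)) -> (forall b, weq (eps adj b)) ->
  is_adjoint_equivalence (dadj homotopical_derived_adjunction).
Proof.
move=> eta_weq eps_weq.
by split=> x; [apply: loc_functor_iso (eta_weq x) | apply: loc_functor_iso (eps_weq x)].
Qed.

End HomotopicalAdjunction.

(** [jH] inverts weak equivalences and so factors through [Ho Gph_model] directly, which avoids
    comparing [Ho cZSet_model] with [cZSet]. *)
Lemma ho_gph_equivalent : equivalent (Ho Gph_model) cZSet.
Proof.
have jW (X Y : Gph_model) (f : hom X Y) : weq f -> is_iso (fmap jH f) by apply: jH_acyclic.
pose F : functor (Ho Gph_model) cZSet := ho_lift jW.
pose K : functor cZSet (Ho Gph_model) := gamma Gph_model \of Giota.
have FE (X Y : Gph_model) (f : hom X Y) :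
    fmap F (fmap (gamma Gph_model) f) = fmap jH f by apply: (ho_liftE jW).
have eps_nat' (X Y : Gph) (f : hom X Y) :
    fmap (fid (Ho Gph_model) \of gamma Gph_model) f
      \oc fmap (gamma Gph_model) (eps Giota_jH X) =
    fmap (gamma Gph_model) (eps Giota_jH Y) \oc fmap ((K \of F) \of gamma Gph_model) f.
  rewrite -[fmap ((_ \of _) \of _) f]/(fmap K (fmap F (fmap (gamma Gph_model) f))) FE.
  rewrite -[LHS]/(fmap (gamma Gph_model) _ \oc fmap (gamma Gph_model) _).
  rewrite -[RHS]/(fmap (gamma Gph_model) _ \oc fmap (gamma Gph_model) _).
  by rewrite -!fmapM eps_nat.
pose e : nattrans (K \of F) (fid (Ho Gph_model)) :=
  loc_nattrans (@NatTrans _ _ ((K \of F) \of gamma Gph_model)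
    (fid (Ho Gph_model) \of gamma Gph_model)
    (fun X => fmap (gamma Gph_model) (eps Giota_jH X)) eps_nat').
have e_iso : is_natiso e by move=> X; apply: loc_functor_iso (@eps_gph_acyclic X).
have eta_nat' (S T : cZSet) (f : hom S T) :
    fmap (F \of K) f \oc eta Giota_jH S = eta Giota_jH T \oc fmap (fid cZSet) f.
  rewrite [fmap (_ \of _) f]FE; exact: (eta_nat Giota_jH).
pose h : nattrans (fid cZSet) (F \of K) :=
  @NatTrans _ _ (fid cZSet) (F \of K) (fun S => eta Giota_jH S) eta_nat'.
(* [e] and [h] point the opposite way to the transformations in [equivalent], so their inverses are
   taken. *)
have [a a_iso _] := natiso_inv e_iso.
have [b b_iso _] := natiso_inv (eta_czset_iso : is_natiso h).
by exists F, K, a, b.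
Qed.

Theorem mainTheorem1 :
  (exists adj : @adjunction cZSet Gph Giota jH,
     @is_quillen_equivalence cZSet_model Gph_model Giota jH adj) /\
  equivalent (Ho Gph_model) cZSet.
Proof.
split; last exact: ho_gph_equivalent.
exists Giota_jH; split; first exact: Giota_jH_quillen.
have L_weq (S T : cZSet_model) (f : hom S T) :
    weq f -> @weq Gph_model _ _ (fmap Giota f).
  by move=> f_iso; apply/acyclic_iso/is_iso_fmap.
have R_weq (X Y : Gph_model) (f : hom X Y) :
    weq f -> @weq cZSet_model _ _ (fmap jH f) by apply: jH_acyclic.
exists (@homotopical_derived_adjunction cZSet_model Gph_model _ _ Giota_jH L_weq R_weq).
apply: homotopical_quillen_equivalence; first exact: eta_czset_iso.
exact: eps_gph_acyclic.
Qed.
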